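(* Let $\mathsf{Mot}$ be the module of (localized) point-counting functions of schemes of finite type over $\mathbf{Z}$, and let $\mathsf{Graphs}_*\subseteq\mathsf{Mot}$ be the $\mathsf{R}$-submodule generated by the functions $[Z_G]$, where $G$ runs over all finite simple graphs. Then $$\mathsf{Graphs}_*=\mathsf{Mot}.$$
   Context: Let $\mathcal{Q}$ be the set of prime powers $q=p^m$ ($p$ prime, $m\ge 1$). For a scheme $X$ of finite type over $\mathbf{Z}$, $[X]:\mathcal{Q}\to\mathbf{Z}$ denotes the function $q\mapsto \# X(\mathbf{F}_q)$. $\mathsf{Mot}^+$ is the additive group of functions generated by all $[X]$, $X$ a scheme of finite type over $\mathbf{Z}$; it is a ring and a $\mathbf{Z}[q]$-module. Let $\mathsf{S}\subset\mathbf{Z}[q]$ be the saturated multiplicative system generated by the polynomials $q^n-q$, $n>1$ (saturated: closed under taking divisors). Elements of $\mathsf{S}$ do not vanish on $\mathcal{Q}$. Put $\mathsf{R}=\mathsf{S}^{-1}\mathbf{Z}[q]$ and $\mathsf{Mot}=\mathsf{S}^{-1}\mathsf{Mot}^+$; elements of both are viewed as functions $\mathcal{Q}\to\mathbf{Q}$. A simple graph is one with no loops and no multiple edges. For a finite simple graph $G$ with vertices $v_1,\dots,v_n$, $Z_G$ is the scheme over $\mathbf{Z}$ of all nondegenerate (invertible) symmetric $n\times n$ matrices $M$ such that $M_{ij}=0$ whenever there is an edge from $v_i$ to $v_j$. Thus $[Z_G](q)$ is the number of such matrices over $\mathbf{F}_q$. *)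

(* Defs.v *)
From HB Require Import structures.
From mathcomp Require Import all_boot all_order all_algebra.
From mathcomp Require Import all_classical.

Set Implicit Arguments.
Unset Strict Implicit.
Unset Printing Implicit Defensive.

Import GRing.Theory.
Local Open Scope classical_set_scope.
Local Open Scope ring_scope.

(* Schemes are given by their functor of points (Demazure-Gabriel, Groupes
   algebriques, I.1): functors from commutative rings to sets.  The zero ring
   is a legitimate argument, hence comPzRingType.  Morphisms are compared
   pointwise in the two functor laws; together the laws imply that
   [fmap] respects pointwise equality. *)
Record zfunctor := ZFunctor {
  points :> comPzRingType -> Type;
  fmap : forall R S : comPzRingType, {rmorphism R -> S} -> points R -> points S;
  fmap_id : forall (R : comPzRingType) (f : {rmorphism R -> R}),
    f =1 id -> fmap f =1 id;
  fmap_comp : forall (R S T : comPzRingType) (f : {rmorphism R -> S})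
      (g : {rmorphism S -> T}) (h : {rmorphism R -> T}),
    h =1 g \o f -> fmap h =1 fmap g \o fmap f }.

Definition unit_ideal (R : comPzRingType) (E : set R) : Prop :=
  exists (n : nat) (c a : 'I_n -> R),
    (forall i, E (a i)) /\ \sum_(i < n) c i * a i = 1.

(* [phi] exhibits S as the localization R[1/f]. *)
Definition is_localization (R S : comPzRingType) (f : R)
    (phi : {rmorphism R -> S}) : Prop :=
  [/\ exists y, phi f * y = 1,
      forall z, exists a k, z * phi f ^+ k = phi a
    & forall a, phi a = 0 -> exists k, f ^+ k * a = 0].

(* X(R) is the equalizer of the X(R_i) => X(R_ij), where the f_i generate the
   unit ideal, R_i = R[1/f_i] and R_ij = R[1/(f_i f_j)].  The case n = 0 says
   that X has exactly one point over the zero ring. *)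
Definition zariski_sheaf (X : zfunctor) : Prop :=
  forall (R : comPzRingType) (n : nat) (f : 'I_n -> R)
    (R1 : 'I_n -> comPzRingType) (R2 : 'I_n -> 'I_n -> comPzRingType)
    (loc : forall i, {rmorphism R -> R1 i})
    (resl : forall i j, {rmorphism R1 i -> R2 i j})
    (resr : forall i j, {rmorphism R1 j -> R2 i j}),
    unit_ideal (range f) ->
    (forall i, is_localization (f i) (loc i)) ->
    (forall i j, is_localization (f i * f j) (resl i j \o loc i)) ->
    (forall i j, resl i j \o loc i =1 resr i j \o loc j) ->
  forall x : forall i, X (R1 i),
    (forall i j, fmap (resl i j) (x i) = fmap (resr i j) (x j)) ->
    exists! y : X R, forall i, fmap (loc i) y = x i.

(* By Yoneda, u : X A is a morphism Spec A -> X; on R-points it sends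
   phi : A -> R to [fmap phi u]. *)
Definition in_chart (X : zfunctor) (A : comPzRingType) (u : X A)
    (R : comPzRingType) (x : X R) : Prop :=
  exists phi : {rmorphism A -> R}, fmap phi u = x.

(* Spec A -> X is an open immersion: it is a monomorphism and its pullback
   along every Spec B -> X is the open subfunctor D(I) of Spec B for a set
   (equivalently, an ideal) I of B. *)
Definition open_chart (X : zfunctor) (A : comPzRingType) (u : X A) : Prop :=
  (forall (R : comPzRingType) (phi psi : {rmorphism A -> R}),
     fmap phi u = fmap psi u -> phi =1 psi) /\
  (forall (B : comPzRingType) (x : X B), exists I : set B,
     forall (R : comPzRingType) (f : {rmorphism B -> R}),
       in_chart u (fmap f x) <-> unit_ideal (f @` I)).

Definition subring (A : comPzRingType) (P : set A) : Prop :=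
  [/\ P 1, forall x y, P x -> P y -> P (x - y)
    & forall x y, P x -> P y -> P (x * y)].

Definition finitely_generated (A : comPzRingType) : Prop :=
  exists E : set A, finite_set E /\ smallest (@subring A) E = setT.

(* Scheme of finite type over Z: a Zariski sheaf with a finite cover by open
   affines Spec A_i, each A_i a finitely generated ring.  A family of open
   subfunctors covers when it does so on points with values in fields. *)
Definition scheme_of_finite_type (X : zfunctor) : Prop :=
  zariski_sheaf X /\
  exists (n : nat) (A : 'I_n -> comPzRingType) (u : forall i, X (A i)),
    [/\ forall i, finitely_generated (A i),
        forall i, open_chart (u i)
      & forall (K : fieldType) (x : X K), exists i, in_chart (u i) x].

Definition prime_power (q : nat) : bool :=
  `[< exists p m : nat, [/\ prime p, (0 < m)%N & q = (p ^ m)%N] >].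

Definition primepower := {q : nat | prime_power q}.

Definition fct := primepower -> rat.

(* f = [X], i.e. f(q) = #X(F_q); the field F_q is unique up to isomorphism. *)
Definition is_point_count (X : zfunctor) (f : fct) : Prop :=
  forall (q : primepower) (F : finFieldType), #|F| = val q ->
    exists n : nat, ([set: X F] #= `I_n)%card /\ f q = n%:R.

Definition additive_subgroup (V : set fct) : Prop :=
  V (fun=> 0) /\ forall f g, V f -> V g -> V (fun q => f q - g q).

Definition Mot_plus : set fct :=
  smallest additive_subgroup
    [set f | exists2 X, scheme_of_finite_type X & is_point_count X f].

Definition saturated_mult_system (S : set {poly int}) : Prop :=
  [/\ S 1, forall a b, S a -> S b -> S (a * b)
    & forall a b, S (a * b) -> S a].

Definition SS : set {poly int} :=
  smallest saturated_mult_system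
    [set p | exists2 n : nat, (1 < n)%N & p = 'X^n - 'X].

Definition evalq (p : {poly int}) : fct := fun q => (p.[(val q)%:Z])%:~R.

(* Elements of SS have no zero on prime powers, so the two localizations below
   embed into functions and the divisions are genuine. *)
Definition RR : set fct :=
  [set r | exists p s : {poly int}, SS s /\ r = fun q => evalq p q / evalq s q].

Definition Mot : set fct :=
  [set f | exists (g : fct) (s : {poly int}),
     [/\ Mot_plus g, SS s & f = fun q => g q / evalq s q]].

Record simple_graph := SimpleGraph {
  nverts : nat;
  edge : rel 'I_nverts;
  edge_sym : symmetric edge;
  edge_irrefl : irreflexive edge }.

Section GraphScheme.
Variable G : simple_graph.

Definition ZG_matrix (R : comPzRingType) (M : 'M[R]_(nverts G)) : Prop :=
  [/\ M^T = M,
      exists N : 'M[R]_(nverts G), M *m N = 1%:M /\ N *m M = 1%:M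
    & forall i j, edge i j -> M i j = 0].

Definition ZG_points (R : comPzRingType) : Type :=
  {M : 'M[R]_(nverts G) | ZG_matrix M}.

Lemma ZG_matrix_map (R S : comPzRingType) (f : {rmorphism R -> S})
    (M : 'M[R]_(nverts G)) : ZG_matrix M -> ZG_matrix (map_mx f M).
Proof.
case=> symM [N [MN NM]] zM; split.
- by rewrite map_trmx symM.
- by exists (map_mx f N); rewrite -!map_mxM MN NM map_mx1.
- by move=> i j /zM Mij; rewrite mxE Mij rmorph0.
Qed.

Definition ZG_fmap (R S : comPzRingType) (f : {rmorphism R -> S})
    (M : ZG_points R) : ZG_points S :=
  exist _ (map_mx f (sval M)) (ZG_matrix_map f (svalP M)).

Lemma ZG_fmap_id (R : comPzRingType) (f : {rmorphism R -> R}) :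
  f =1 id -> ZG_fmap f =1 id.
Proof.
by move=> fE [M zM]; apply: eq_exist; apply/matrixP=> i j; rewrite mxE fE.
Qed.

Lemma ZG_fmap_comp (R S T : comPzRingType) (f : {rmorphism R -> S})
    (g : {rmorphism S -> T}) (h : {rmorphism R -> T}) :
  h =1 g \o f -> ZG_fmap h =1 ZG_fmap g \o ZG_fmap f.
Proof.
by move=> hE [M zM]; apply: eq_exist; apply/matrixP=> i j; rewrite !mxE hE.
Qed.

Definition ZG : zfunctor := ZFunctor ZG_fmap_id ZG_fmap_comp.

End GraphScheme.

Definition R_submodule (V : set fct) : Prop :=
  [/\ V (fun=> 0),
      forall f g, V f -> V g -> V (fun q => f q + g q)
    & forall r f, RR r -> V f -> V (fun q => r q * f q)].

Definition Graphs_star : set fct :=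
  smallest R_submodule [set f | exists G, is_point_count (ZG G) f].

(* Main.v *)
(* Inclusion of Graphs_star in Mot: Z_G is the zero set of finitely many integral
   polynomials, and a scheme X of finite type is counted by affine pieces.  If
   Spec A_1, ..., Spec A_n are charts, the points lying in chart i but in no earlier
   chart are the points of a closed subscheme of Spec A_i, which by Hilbert's basis
   theorem is the zero set of finitely many polynomials.

   Inclusion of Mot in Graphs_star: it is enough to treat the number of zeros of a
   finite list of integral polynomials.
   - Adding an isolated vertex to G leaves the new row of the matrix free, and the
     number of extensions of given rank only depends on the rank of the old matrix.
     Solving the resulting triangular system over R shows that the number of
     symmetric matrices of any rank with zero pattern G lies in Graphs_star; by
     inclusion-exclusion so does the number of those with prescribed zero and
     prescribed nonzero entries off the diagonal.
   - A symmetric matrix of rank 3 is the Gram matrix of a family of vectors of a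
     three-dimensional quadratic space, and a zero entry is an orthogonality.  Using
     polars, some of the vectors may be read as lines of the projective plane, the
     others as points, and the zero entries as incidences.  Von Staudt's
     constructions of sum and product then express any polynomial equation.  Each
     constructed point or line is determined up to a nonzero scalar by the previous
     ones, so the number of these matrices is the number of solutions times a power
     of q - 1. *)
From HB Require Import structures.
From mathcomp Require Import all_boot all_order all_algebra all_fingroup.
From mathcomp Require Import all_solvable all_field mxabelem all_classical.
From mathcomp Require Import ring zify.
Require Import Defs.

Set Implicit Arguments.
Unset Strict Implicit.
Unset Printing Implicit Defensive.

Import GRing.Theory Num.Theory.
Local Open Scope ring_scope.

(** * Finite fields and point counts *)

Lemma finField_generator (F : finFieldType) :
  exists a : F, forall x, x != 0 -> exists k, x = a ^+ k.
Proof.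
have /cyclicP[u genu] := field_unit_group_cyclic [set: {unit F}].
exists (val u) => x nzx.
have xU : x \is a GRing.unit by rewrite unitfE.
have : FinRing.unit F xU \in <[u]>%g by rewrite -genu inE.
by case/cycleP=> k Dx; exists k; rewrite -FinRing.val_unitX -Dx.
Qed.

(* The generator a of F^* and the minimal polynomial g of a over F_p: g divides
   X^q - X, which splits in F', so a can be sent to a root of g in F'. *)
Lemma finField_hom (F F' : finFieldType) (p m : nat) :
  prime p -> #|F| = (p ^ m)%N -> #|F'| = (p ^ m)%N ->
  inhabited {rmorphism F -> F'}.
Proof.
move=> p_pr cF cF'.
have pF := card_finPcharP cF p_pr; have pF' := card_finPcharP cF' p_pr.
pose L : algType 'F_p := pPrimeCharType pF.
pose L' : algType 'F_p := pPrimeCharType pF'.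
have [a gena] := finField_generator F.
pose ha : {rmorphism {poly 'F_p} -> L} := horner_alg (a : L).
have surj_ha x : exists h, ha h == x.
  have [->|/gena[k ->]] := eqVneq x 0; first by exists 0; rewrite rmorph0.
  by exists ('X^k); rewrite rmorphXn /= [horner_alg _ _]horner_algX.
pose n := #|F|; pose P : {poly 'F_p} := 'X^n - 'X.
have n_gt1 : (1 < n)%N := finNzRing_gt1 F.
have nzP : P != 0.
  by rewrite -size_poly_eq0 size_polyDl ?size_polyXn ?size_polyN ?size_polyX.
have haP : ha P = 0.
  rewrite rmorphB rmorphXn /= [X in X ^+ _]horner_algX [X in _ - X]horner_algX.
  by rewrite /n expf_card subrr.
pose isz k := `[< exists g : {poly 'F_p}, [/\ size g = k, g != 0 & ha g = 0] >].
have ex_g : exists k, isz k by exists (size P); apply/asboolP; exists P.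
have [_ /asboolP[g [<- nzg hag]] ming] := ex_minnP ex_g.
have dvd_g h : ha h = 0 -> g %| h.
  move=> hah; rewrite /dvdp; apply: contraT => nzr.
  have /ming : isz (size (h %% g)).
    apply/asboolP; exists (h %% g); split=> //.
    by have := congr1 ha (divp_eq h g); rewrite rmorphD rmorphM hag mulr0 add0r hah.
  by rewrite leqNgt ltn_modp nzg.
have szg : size g != 1%N.
  apply/negP => /size_poly1P[c nzc Dg]; move: hag; rewrite Dg.
  rewrite [ha _]horner_algC => /eqP; rewrite scaler_eq0.
  by rewrite (negPf nzc) oner_eq0.
have [phi phiE] : exists phi : {rmorphism 'F_p -> F'}, phi =1 in_alg L'.
  by pose phi : {rmorphism 'F_p -> L'} := in_alg L'; exists phi.
pose gL := map_poly phi g.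
have /dvdp_prod_XsubC[msk eqg] : gL %| \prod_(x <- enum F') ('X - x%:P).
  rewrite big_enum /= -finField_genPoly cF' -cF -/n.
  have <- : map_poly phi P = 'X^n - 'X.
    by rewrite [LHS](rmorphB (map_poly phi)) /= (map_polyXn phi) (map_polyX phi).
  by rewrite dvdp_map dvd_g.
have [b rootb] : exists b, root gL b.
  case Dm: (mask msk _) eqg => [|b s] eqg.
    move/eqp_size: eqg; rewrite big_nil size_poly1 size_map_poly.
    by move/eqP; rewrite (negPf szg).
  by exists b; rewrite (eqp_root eqg) big_cons rootM root_XsubC eqxx.
pose hb : {rmorphism {poly 'F_p} -> L'} := horner_alg (b : L').
have hbg : hb g = 0.
  by move/eqP: rootb; rewrite /gL (eq_map_poly phiE).
have hab h : ha h = 0 -> hb h = 0.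
  by case/dvd_g/dvdpP=> r ->; rewrite rmorphM hbg mulr0.
have hab2 h h' : ha h = ha h' -> hb h = hb h'.
  move/eqP; rewrite -subr_eq0 -rmorphB => /eqP/hab/eqP.
  by rewrite rmorphB subr_eq0 => /eqP.
(* The morphism sends h(a) to h(b); [hab2] makes this independent of the polynomial h chosen for
   x. *)
pose pre x := xchoose (surj_ha x).
have preK x : ha (pre x) = x by exact: (eqP (xchooseP (surj_ha x))).
pose f x := hb (pre x).
have fB : zmod_morphism f.
  by move=> x y; rewrite /f -rmorphB; apply: hab2; rewrite rmorphB !preK.
have fM : monoid_morphism f.
  split=> [|x y]; first by rewrite /f -(rmorph1 hb); apply: hab2;
    rewrite preK rmorph1.
  by rewrite /f -rmorphM; apply: hab2; rewrite rmorphM !preK.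
pose f1 := GRing.isZmodMorphism.Build F F' f fB.
pose f2 := GRing.isMonoidMorphism.Build F F' f fM.
pose fr : {rmorphism F -> F'} := HB.pack f f1 f2.
exact: inhabits fr.
Qed.

Lemma finField_iso (F F' : finFieldType) (p m : nat) :
  prime p -> #|F| = (p ^ m)%N -> #|F'| = (p ^ m)%N ->
  exists (f : {rmorphism F -> F'}) (g : {rmorphism F' -> F}),
    cancel f g /\ cancel g f.
Proof.
move=> p_pr cF cF'; have [f] := finField_hom p_pr cF cF'.
have [|g fK gK] := @inj_card_bij _ _ f (fmorph_inj f); first by rewrite cF cF'.
pose g1 := GRing.isZmodMorphism.Build F' F g (can2_zmod_morphism fK gK).
pose g2 := GRing.isMonoidMorphism.Build F' F g (can2_monoid_morphism fK gK).
pose gr : {rmorphism F' -> F} := HB.pack g g1 g2.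
by exists f, gr.
Qed.

Lemma card_pred_bij (A B : finType) (P : pred A) (Q : pred B) (g : A -> B) :
    {in P &, injective g} -> (forall x, x \in P -> g x \in Q) ->
    (forall y, y \in Q -> exists2 x, x \in P & g x = y) ->
  #|P| = #|Q|.
Proof.
move=> ginj gPQ gsurj; rewrite -(card_in_image ginj).
apply: eq_card => y; apply/fintype.imageP/idP => [[x Px ->]|]; first exact: gPQ.
by case/gsurj=> x Px <-; exists x.
Qed.

Lemma Fq_subproof (q : primepower) : exists F : finFieldType, #|F| = val q.
Proof.
case: q => q /= /asboolP[p [m [p_pr m_gt0 ->]]].
by have [F _ cF] := pPrimePowerField p_pr m_gt0; exists F.
Qed.

Definition Fq (q : primepower) : finFieldType := sval (cid (Fq_subproof q)).

Lemma card_Fq (q : primepower) : #|Fq q| = val q.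
Proof. exact: svalP (cid (Fq_subproof q)). Qed.

Lemma primepower_gt1 (q : primepower) : (1 < val q)%N.
Proof. by rewrite -card_Fq finNzRing_gt1. Qed.

Local Open Scope classical_set_scope.

Lemma card_eq_finType (T : finType) (A : pred T) : ([set` A] #= `I_#|A|)%card.
Proof.
apply: card_eq_trans (card_esym card_II).
suff -> : [set` A] = (@enum_val _ A) @` [set: 'I_#|A|].
  by apply: inj_card_eq => i j _ _; apply: enum_val_inj.
apply/seteqP; split=> [x /= Ax|x [i _ <-]]; last exact: enum_valP.
by exists (enum_rank_in Ax x); rewrite // enum_rankK_in.
Qed.

(** The points of a functor form a bare type, so they are counted through codes in a finite type. *)
Lemma card_eq_encoding (T : Type) (T' : finType) (A : pred T') (g : T -> T') :
    injective g -> (forall x, g x \in A) -> (forall y, y \in A -> exists x, g x =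
      y) ->
  ([set: T] #= `I_#|A|)%card.
Proof.
move=> ginj gA gsurj; apply: card_eq_trans (card_eq_finType A).
suff <- : g @` [set: T] = [set` A].
  by apply/card_esym/inj_card_eq => x y _ _; apply: ginj.
apply/seteqP; split=> [_ [x _ <-]|y /gsurj[x <-]].
  exact: gA.
by exists x.
Qed.

(** All fields with q elements are isomorphic, and functoriality turns an isomorphism into a
    bijection of points; counting over the chosen field [Fq q] is therefore enough. *)
Lemma is_point_count_Fq (X : zfunctor) (c : primepower -> nat) :
  (forall q, [set: X (Fq q)] #= `I_(c q))%card ->
  is_point_count X (fun q => (c q)%:R).
Proof.
move=> cX q F cF; exists (c q); split=> //.
apply: card_eq_trans (cX q).
have /asboolP[p [m [p_pr _ Dq]]] := svalP q.
have [] := @finField_iso F (Fq q) p m p_pr; rewrite ?cF ?card_Fq //.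
move=> f [g [fK gK]].
have XfK : cancel (@fmap X _ _ f) (fmap g).
  move=> x; rewrite -[fmap g _](@fmap_comp X _ _ _ f g idfun) => [|y] /=.
    by rewrite fmap_id.
  by rewrite fK.
have XgK : cancel (@fmap X _ _ g) (fmap f).
  move=> x; rewrite -[fmap f _](@fmap_comp X _ _ _ g f idfun) => [|y] /=.
    by rewrite fmap_id.
  by rewrite gK.
have -> : [set: X (Fq q)] = (@fmap X _ _ f) @` [set: X F].
  by apply/seteqP; split=> // x _; exists (fmap g x).
by apply/card_esym/inj_card_eq => x y _ _; apply: can_inj XfK _ _.
Qed.

Lemma is_point_count_inv (X : zfunctor) (f : fct) (c : primepower -> nat) :
  (forall q, [set: X (Fq q)] #= `I_(c q))%card ->
  is_point_count X f -> f = fun q => (c q)%:R.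
Proof.
move=> cX cf; apply: funext => q; have [n [Xn ->]] := cf q (Fq q) (card_Fq q).
by congr _%:R; apply/esym/card_eq_II/(card_eq_trans (card_esym (cX q))).
Qed.

(** * The affine scheme of a system of equations *)

(** Integral polynomials as terms that evaluate in any commutative ring. The single constant -1 is
    enough, since 1 = (-1)(-1) and 0 = 1 + (-1). *)
Inductive expr (I : Type) :=
  | Var of I
  | Mone
  | Add of expr I & expr I
  | Mul of expr I & expr I.
Arguments Mone {I}.

HB.instance Definition _ I := gen_eqMixin (expr I).
HB.instance Definition _ I := gen_choiceMixin (expr I).

Fixpoint ev I (R : comPzRingType) (x : I -> R) (t : expr I) : R :=
  match t with
  | Var i => x i
  | Mone => - 1
  | Add t u => ev x t + ev x u
  | Mul t u => ev x t * ev x u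
  end.

Definition One {I} : expr I := Mul Mone Mone.
Definition Opp I (t : expr I) := Mul Mone t.
Definition Zero {I} : expr I := Add One Mone.

Lemma ev_One I (R : comPzRingType) (x : I -> R) : ev x One = 1.
Proof. by rewrite /= mulrNN mulr1. Qed.

Lemma ev_Opp I (R : comPzRingType) (x : I -> R) t : ev x (Opp t) = - ev x t.
Proof. by rewrite /= mulN1r. Qed.

Lemma ev_Zero I (R : comPzRingType) (x : I -> R) : ev x Zero = 0.
Proof. by rewrite [LHS]/= -/(ev x One) mulrNN mulr1 subrr. Qed.

Lemma ev_rmorph I (R S : comPzRingType) (f : {rmorphism R -> S}) (x : I -> R) t :
  f (ev x t) = ev (f \o x) t.
Proof.
elim: t => //= [|t <- u <-|t <- u <-]; first by rewrite rmorphN1.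
  by rewrite rmorphD.
by rewrite rmorphM.
Qed.

Lemma eq_ev I (R : comPzRingType) (x y : I -> R) : x =1 y -> ev x =1 ev y.
Proof. by move=> exy; elim=> //= [t -> u ->|t -> u ->]. Qed.

Definition vanish I (R : comPzRingType) (T : seq (expr I)) (x : I -> R) :=
  all (fun t => ev x t == 0) T.

Lemma vanishP I (R : comPzRingType) (T : seq (expr I)) (x : I -> R) :
  reflect (forall t, t \in T -> ev x t = 0) (vanish T x).
Proof. by apply: (iffP allP) => H t Tt; apply/eqP/H. Qed.

Lemma eq_vanish I (R : comPzRingType) (T : seq (expr I)) (x y : I -> R) :
  x =1 y -> vanish T x = vanish T y.
Proof. by move=> /eq_ev exy; apply: eq_all => t; rewrite exy. Qed.

Lemma vanish_rmorph I (R S : comPzRingType) (f : {rmorphism R -> S})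
    (T : seq (expr I)) (x : I -> R) : vanish T x -> vanish T (f \o x).
Proof.
by move/vanishP=> xT; apply/vanishP=> t Tt; rewrite -ev_rmorph xT ?rmorph0.
Qed.

Section AffineScheme.
Variables (I : finType) (T : seq (expr I)).

Definition Aff_points (R : comPzRingType) : Type := {x : I -> R | vanish T x}.

Definition Aff_fmap (R S : comPzRingType) (f : {rmorphism R -> S})
    (x : Aff_points R) : Aff_points S :=
  exist _ (f \o sval x) (vanish_rmorph f (svalP x)).

Lemma Aff_points_eq (R : comPzRingType) (x y : Aff_points R) :
  sval x =1 sval y -> x = y.
Proof. by case: x y => x px [y py] /= /funext exy; apply: eq_exist. Qed.

Lemma Aff_fmap_id (R : comPzRingType) (f : {rmorphism R -> R}) :
  f =1 id -> Aff_fmap f =1 id.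
Proof. by move=> fE x; apply: Aff_points_eq => i /=. Qed.

Lemma Aff_fmap_comp (R S U : comPzRingType) (f : {rmorphism R -> S})
    (g : {rmorphism S -> U}) (h : {rmorphism R -> U}) :
  h =1 g \o f -> Aff_fmap h =1 Aff_fmap g \o Aff_fmap f.
Proof. by move=> hE x; apply: Aff_points_eq => i /=; rewrite hE. Qed.

Definition Aff : zfunctor := ZFunctor Aff_fmap_id Aff_fmap_comp.

Definition coord_equiv (t u : expr I) : bool :=
  `[< forall (R : comPzRingType) (x : I -> R), vanish T x -> ev x t = ev x u >].

Lemma coord_equiv_refl : reflexive coord_equiv.
Proof. by move=> t; apply/asboolP. Qed.

Lemma coord_equiv_sym : symmetric coord_equiv.
Proof.
by move=> t u; apply: asbool_equiv_eq; split=> H R x xT; rewrite (H R).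
Qed.

Lemma coord_equiv_trans : transitive coord_equiv.
Proof.
by move=> t u v /asboolP H /asboolP K; apply/asboolP=> R x xT; rewrite H ?K.
Qed.

Canonical coord_equiv_rel :=
  EquivRel coord_equiv coord_equiv_refl coord_equiv_sym coord_equiv_trans.

(* The coordinate ring Z[I]/(T), as expressions modulo equality of their values
   at all T-points; the ring axioms and the universal property then hold because
   they hold in every ring. *)
Definition coord_ring := {eq_quot coord_equiv}%qT.
HB.instance Definition _ := Choice.on coord_ring.

Definition cls (t : expr I) : coord_ring := \pi_({eq_quot coord_equiv})%qT t.

Definition crepr (a : coord_ring) : expr I := generic_quotient.repr a.

Lemma clsP t u :
  cls t = cls u <->
  forall (R : comPzRingType) (x : I -> R), vanish T x -> ev x t = ev x u.
Proof.
split=> [/eqmodP/asboolP //|H]; apply/eqmodP; exact/asboolP.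
Qed.

Lemma cls_repr (a : coord_ring) : cls (crepr a) = a.
Proof. exact: reprK. Qed.

Lemma ev_repr (R : comPzRingType) (x : I -> R) t :
  vanish T x -> ev x (crepr (cls t)) = ev x t.
Proof. by move: R x; apply/clsP; rewrite cls_repr. Qed.

Definition cr_add (a b : coord_ring) := cls (Add (crepr a) (crepr b)).
Definition cr_mul (a b : coord_ring) := cls (Mul (crepr a) (crepr b)).
Definition cr_opp (a : coord_ring) := cls (Opp (crepr a)).

Lemma coord_ring_ext (a b : coord_ring) :
  (forall (R : comPzRingType) (x : I -> R),
     vanish T x -> ev x (crepr a) = ev x (crepr b)) -> a = b.
Proof. by move=> H; rewrite -(cls_repr a) -(cls_repr b); apply/clsP. Qed.

Lemma ev_cr_add (R : comPzRingType) (x : I -> R) a b : vanish T x ->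
  ev x (crepr (cr_add a b)) = ev x (crepr a) + ev x (crepr b).
Proof. by move=> xT; rewrite ev_repr. Qed.

Lemma ev_cr_mul (R : comPzRingType) (x : I -> R) a b : vanish T x ->
  ev x (crepr (cr_mul a b)) = ev x (crepr a) * ev x (crepr b).
Proof. by move=> xT; rewrite ev_repr. Qed.

Lemma ev_cr_opp (R : comPzRingType) (x : I -> R) a : vanish T x ->
  ev x (crepr (cr_opp a)) = - ev x (crepr a).
Proof. by move=> xT; rewrite ev_repr // ev_Opp. Qed.

Lemma ev_cr_0 (R : comPzRingType) (x : I -> R) : vanish T x ->
  ev x (crepr (cls Zero)) = 0.
Proof. by move=> xT; rewrite ev_repr // ev_Zero. Qed.

Lemma ev_cr_1 (R : comPzRingType) (x : I -> R) : vanish T x ->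
  ev x (crepr (cls One)) = 1.
Proof. by move=> xT; rewrite ev_repr // ev_One. Qed.

Definition ev_crE := (ev_cr_add, ev_cr_mul, ev_cr_opp, ev_cr_0, ev_cr_1).

Lemma cr_addA : associative cr_add.
Proof.
by move=> a b c; apply: coord_ring_ext => R x xT; rewrite !ev_crE // addrA.
Qed.

Lemma cr_addC : commutative cr_add.
Proof.
by move=> a b; apply: coord_ring_ext => R x xT; rewrite !ev_crE // addrC.
Qed.

Lemma cr_add0 : left_id (cls Zero) cr_add.
Proof.
by move=> a; apply: coord_ring_ext => R x xT; rewrite !ev_crE // add0r.
Qed.

Lemma cr_addN : left_inverse (cls Zero) cr_opp cr_add.
Proof.
by move=> a; apply: coord_ring_ext => R x xT; rewrite !ev_crE // addNr.
Qed.

Lemma cr_mulA : associative cr_mul.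
Proof.
by move=> a b c; apply: coord_ring_ext => R x xT; rewrite !ev_crE // mulrA.
Qed.

Lemma cr_mulC : commutative cr_mul.
Proof.
by move=> a b; apply: coord_ring_ext => R x xT; rewrite !ev_crE // mulrC.
Qed.

Lemma cr_mul1 : left_id (cls One) cr_mul.
Proof.
by move=> a; apply: coord_ring_ext => R x xT; rewrite !ev_crE // mul1r.
Qed.

Lemma cr_mulDl : left_distributive cr_mul cr_add.
Proof.
by move=> a b c; apply: coord_ring_ext => R x xT; rewrite !ev_crE // mulrDl.
Qed.

HB.instance Definition _ :=
  GRing.isZmodule.Build coord_ring cr_addA cr_addC cr_add0 cr_addN.
HB.instance Definition _ :=
  GRing.Zmodule_isComPzRing.Build coord_ring cr_mulA cr_mulC cr_mul1 cr_mulDl.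

Definition coord (i : I) : coord_ring := cls (Var i).

Lemma ev_coord t : ev coord t = cls t.
Proof.
elim: t => //= [|t -> u ->|t -> u ->].
- by apply/clsP => R x xT; rewrite /= ev_repr // ev_One mulr1.
- by apply/clsP => R x xT; rewrite /= !ev_repr.
- by apply/clsP => R x xT; rewrite /= !ev_repr.
Qed.

Lemma vanish_coord : vanish T coord.
Proof.
apply/vanishP=> t Tt; rewrite ev_coord; apply/clsP => R x /vanishP xT.
by rewrite xT // ev_Zero.
Qed.

(** The universal solution, that is the identity of Spec Z[I]/(T): every other solution is its image
    under [coord_hom]. *)
Definition coord_pt : Aff coord_ring := exist _ coord vanish_coord.

Section CoordHom.
Variables (R : comPzRingType) (x : I -> R).
Hypothesis xT : vanish T x.
(** Evaluation on classes is a ring morphism when x is a solution; the proof of [vanish T x] is made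
    an argument so that the morphism instances can be attached. *)
Definition coord_hom of vanish T x := fun a : coord_ring => ev x (crepr a).

Lemma coord_hom_cls t : coord_hom xT (cls t) = ev x t.
Proof. exact: ev_repr. Qed.

Lemma coord_hom_zmod_morphism : zmod_morphism (coord_hom xT).
Proof.
move=> a b; rewrite -[a - b]/(cr_add a (cr_opp b)) coord_hom_cls /= ev_repr //.
by rewrite ev_Opp.
Qed.

Lemma coord_hom_monoid_morphism : monoid_morphism (coord_hom xT).
Proof.
split=> [|a b]; first by rewrite -[1]/(cls One) coord_hom_cls ev_One.
by rewrite -[a * b]/(cr_mul a b) coord_hom_cls.
Qed.

HB.instance Definition _ :=
  GRing.isZmodMorphism.Build coord_ring R (coord_hom xT) coord_hom_zmod_morphism.
HB.instance Definition _ :=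
  GRing.isMonoidMorphism.Build coord_ring R (coord_hom xT)
    coord_hom_monoid_morphism.
End CoordHom.

Lemma coord_pt_in_chart (R : comPzRingType) (x : Aff R) : in_chart coord_pt x.
Proof.
exists (coord_hom (svalP x)).
by apply: Aff_points_eq => i /=; rewrite coord_hom_cls.
Qed.

Lemma coord_ring_finitely_generated : finitely_generated coord_ring.
Proof.
exists (range coord); split; first exact/finite_image/finite_finset.
apply/seteqP; split=> // a _ S [[S1 SB SM] subS]; rewrite -(cls_repr a).
have S0 : S 0 by rewrite -(subrr 1); exact: SB.
have SN u : S u -> S (- u) by rewrite -sub0r; exact: SB.
rewrite -ev_coord; elim: (crepr a) => [i||t IHt u IHu|t IHt u IHu] /=.
- by apply: subS; exists i.
- exact: SN.
- by rewrite -[X in _ + X]opprK; apply: SB => //; apply: SN.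
- exact: SM.
Qed.

Lemma coord_pt_open_chart : open_chart coord_pt.
Proof.
split=> [R phi psi /(congr1 sval)/= eq_phi a|B x].
  by rewrite -(cls_repr a) -ev_coord !ev_rmorph eq_phi.
(* The chart is the whole functor, so its pullback is D(1). *)
exists [set 1] => R f; split=> _; last exact: coord_pt_in_chart.
exists 1%N, (fun=> 1), (fun=> 1); split=> [_|]; last by rewrite big_ord1 mulr1.
by exists 1; rewrite ?rmorph1.
Qed.

End AffineScheme.

(** * Zariski gluing for the zero set of a system of equations *)

Lemma unit_ideal_range (R : comPzRingType) n (f : 'I_n -> R) :
  unit_ideal (range f) -> exists c, \sum_i c i * f i = 1.
Proof.
case=> m [c [a [ex_a <-]]].
have /choice[j aE] : forall l, exists i, f i = a l.
  by move=> l; have [i _ <-] := ex_a l; exists i.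
(* The given combination may repeat some f i; its coefficients are collected along [j]. *)
exists (fun i => \sum_(l | j l == i) c l).
rewrite (partition_big j xpredT) //=; apply: eq_bigr => i _.
rewrite mulr_suml; apply: eq_bigr => l /eqP <-.
by rewrite aE.
Qed.

(** Put x = c_j g_j and let r = 1 - x be the sum of the other terms. Then r divides 1 - x^k, so 1 =
    x^k + r s, and the other coefficients are multiplied by s. *)
Lemma unit_ideal_pow1 (R : comPzRingType) n (c g : 'I_n -> R) j k :
  \sum_i c i * g i = 1 ->
  exists c', \sum_i c' i * (if i == j then g i ^+ k else g i) = 1.
Proof.
rewrite (bigD1 j) //=; set r := \sum_(i | _) _ => sum1.
have Dr : r = 1 - c j * g j by rewrite -sum1 addrAC subrr add0r.
pose s : R := \sum_(i < k) 1 ^+ (k.-1 - i) * (c j * g j) ^+ i.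
have Ds : 1 - (c j * g j) ^+ k = r * s by rewrite Dr -subrXX expr1n.
exists (fun i => if i == j then c j ^+ k else s * c i).
rewrite (bigD1 j) //= eqxx -exprMn -[RHS](subrK ((c j * g j) ^+ k)) Ds addrC.
congr (_ + _); rewrite mulrC mulr_sumr; apply: eq_bigr => i /negPf->.
by rewrite mulrA.
Qed.

Lemma unit_ideal_pow (R : comPzRingType) n (f : 'I_n -> R) k :
  unit_ideal (range f) -> exists c, \sum_i c i * f i ^+ k = 1.
Proof.
move/unit_ideal_range => [c0 sum1].
(* The exponent is raised at one index at a time; [s] lists the indices already treated. *)
suff /(_ (enum 'I_n))[c sumc] : forall s : seq 'I_n, exists c,
    \sum_i c i * (if i \in s then f i ^+ k else f i) = 1.
  by exists c; rewrite -[RHS]sumc; apply: eq_bigr => i _; rewrite mem_enum.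
elim=> [|j s [c sumc]]; first by exists c0.
have [js|njs] := boolP (j \in s).
  exists c; rewrite -[RHS]sumc; apply: eq_bigr => i _.
  by rewrite inE; case: eqP => // ->; rewrite js.
have [c' sumc'] := unit_ideal_pow1 j k sumc.
exists c'; rewrite -[RHS]sumc'; apply: eq_bigr => i _.
by rewrite inE; case: eqP => //= ->; rewrite (negPf njs).
Qed.

(** Write x_i = b_i / f_i^K with one exponent K, large enough for b_i f_j^K = b_j f_i^K to hold in
    R. If the c_j f_j^K sum to 1, the glued element is the sum of the c_j b_j. *)
Lemma localization_glue (R : comPzRingType) (n : nat) (f : 'I_n -> R)
    (R1 : 'I_n -> comPzRingType) (R2 : 'I_n -> 'I_n -> comPzRingType)
    (loc : forall i, {rmorphism R -> R1 i})
    (resl : forall i j, {rmorphism R1 i -> R2 i j})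
    (resr : forall i j, {rmorphism R1 j -> R2 i j}) (x : forall i, R1 i) :
    unit_ideal (range f) ->
    (forall i, is_localization (f i) (loc i)) ->
    (forall i j, is_localization (f i * f j) (resl i j \o loc i)) ->
    (forall i j, resl i j \o loc i =1 resr i j \o loc j) ->
    (forall i j, resl i j (x i) = resr i j (x j)) ->
  exists y : R, forall i, loc i y = x i.
Proof.
move=> f1 locP locP2 res_comm x_comm.
have /choice[ae aE] : forall i, exists ae : R * nat,
    x i * loc i (f i) ^+ ae.2 = loc i ae.1.
  move=> i; have [_ /(_ (x i))[a [k xE]] _] := locP i.
  by exists (a, k).
pose k := \max_i (ae i).2.
have [b bE] : exists b, forall i, x i * loc i (f i) ^+ k = loc i (b i).
  exists (fun i => (ae i).1 * f i ^+ (k - (ae i).2)) => i;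
    rewrite rmorphM rmorphXn -aE -mulrA -exprD subnKC //.
  exact: (leq_bigmax (F := fun i => (ae i).2)).
(* The fractions agree in R_ij, so their cross difference in R is killed by a power of f_i f_j. *)
have /choice[m0 m0E] : forall ij : 'I_n * 'I_n, exists m, (f ij.1 * f ij.2) ^+ m *
    (b ij.1 * f ij.2 ^+ k - b ij.2 * f ij.1 ^+ k) = 0.
  move=> [i j] /=.
  have [_ _] := locP2 i j; apply; rewrite rmorphB.
  apply/eqP; rewrite subr_eq0; apply/eqP.
  rewrite [RHS]res_comm /= !(rmorphM, rmorphXn) /= -!bE !(rmorphM, rmorphXn) /=.
  have := res_comm i j (f j); have := res_comm i j (f i) => /= -> ->.
  by rewrite x_comm mulrAC.
(* Multiplying numerator and denominator by f_i^m absorbs these powers, m being at least every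
   [m0]. *)
pose m := \max_ij m0 ij; pose K := (k + m)%N; pose b' i := b i * f i ^+ m.
have b'E i : x i * loc i (f i) ^+ K = loc i (b' i).
  by rewrite exprD mulrA bE rmorphM rmorphXn.
have b'b' i j : b' i * f j ^+ K = b' j * f i ^+ K.
  apply/eqP; rewrite -subr_eq0; apply/eqP.
  have -> : b' i * f j ^+ K - b' j * f i ^+ K =
      (f i * f j) ^+ m * (b i * f j ^+ k - b j * f i ^+ k).
    by rewrite /b' /K !exprD exprMn; ring.
  rewrite -[m](subnK (leq_bigmax (F := m0) (i, j))) exprD -mulrA.
  by rewrite (m0E (i, j)) mulr0.
have [c sumc] := unit_ideal_pow K f1.
exists (\sum_j c j * b' j) => i.
have [[u fu] _ _] := locP i.
have cancel_fK (z z' : R1 i) : z * loc i (f i) ^+ K = z' * loc i (f i) ^+ K -> z =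
    z'.
  move/(congr1 ( *%R^~ (u ^+ K))); rewrite -!mulrA -exprMn fu expr1n.
  by rewrite !mulr1.
apply: cancel_fK; rewrite b'E -rmorphXn -rmorphM mulr_suml; congr (loc i _).
rewrite -[RHS]mul1r -sumc mulr_suml; apply: eq_bigr => j _.
by rewrite -mulrA b'b' [b' i * _]mulrC mulrA.
Qed.

(** The difference is killed by a power of each f_i, and powers with a common exponent still
    generate the unit ideal. *)
Lemma localization_separated (R : comPzRingType) (n : nat) (f : 'I_n -> R)
    (R1 : 'I_n -> comPzRingType) (loc : forall i, {rmorphism R -> R1 i}) (y z : R) :
    unit_ideal (range f) -> (forall i, is_localization (f i) (loc i)) ->
  (forall i, loc i y = loc i z) -> y = z.
Proof.
move=> f1 locP yz; apply/eqP; rewrite -subr_eq0; apply/eqP.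
have /choice[e eE] : forall i, exists e, f i ^+ e * (y - z) = 0.
  move=> i; have [_ _] := locP i; apply.
  by rewrite rmorphB yz subrr.
have [c sumc] := unit_ideal_pow (\max_i e i) f1.
rewrite -[LHS]mul1r -sumc mulr_suml big1 // => i _.
by rewrite -(subnK (leq_bigmax (F := e) i)) exprD -!mulrA eE !mulr0.
Qed.

Section AffineSchemeSheaf.
Variables (I : finType) (T : seq (expr I)).

(** Coordinates are glued one at a time; the glued point satisfies the equations because it does so
    in each localization. *)
Lemma Aff_zariski_sheaf : zariski_sheaf (Aff T).
Proof.
move=> R n f R1 R2 loc resl resr f1 locP locP2 res_comm x x_comm.
have x_comm_i i j a : resl i j (sval (x i) a) = resr i j (sval (x j) a).
  by have /(congr1 (fun u => sval u a)) := x_comm i j.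
have /choice[y yE] : forall a, exists y, forall i, loc i y = sval (x i) a.
  move=> a; apply: (localization_glue f1 locP locP2 res_comm).
  by move=> i j; apply: x_comm_i.
have yT : vanish T y.
  apply/vanishP=> t Tt; apply: (localization_separated f1 locP) => i.
  rewrite ev_rmorph rmorph0 (eq_ev (y := sval (x i))) => [|a] /=; last exact: yE.
  exact: (vanishP _ _ (svalP (x i))).
exists (exist _ y yT); split=> [i|z zE]; first by apply: Aff_points_eq => a;
  apply: yE.
apply: Aff_points_eq => a /=; apply: (localization_separated f1 locP) => i.
by rewrite yE -zE.
Qed.

Lemma Aff_scheme_of_finite_type : scheme_of_finite_type (Aff T).
Proof.
split; first exact: Aff_zariski_sheaf.
exists 1%N, (fun=> coord_ring T), (fun=> coord_pt T); split=> [_|_|K x].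
- exact: coord_ring_finitely_generated.
- exact: coord_pt_open_chart.
- by exists ord0; apply: coord_pt_in_chart.
Qed.

End AffineSchemeSheaf.

(** * Additive and R-linear spans of functions *)

Lemma evalq0 : evalq 0 = fun=> 0.
Proof. by apply: funext => q; rewrite /evalq horner0. Qed.

Lemma evalq1 q : evalq 1 q = 1.
Proof. by rewrite /evalq hornerC. Qed.

Lemma evalqD a b q : evalq (a + b) q = evalq a q + evalq b q.
Proof. by rewrite /evalq hornerD rmorphD. Qed.

Lemma evalqN a q : evalq (- a) q = - evalq a q.
Proof. by rewrite /evalq hornerN rmorphN. Qed.

Lemma evalqM a b q : evalq (a * b) q = evalq a q * evalq b q.
Proof. by rewrite /evalq hornerM rmorphM. Qed.

Lemma evalqX q : evalq 'X q = (val q)%:R.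
Proof. by rewrite /evalq hornerX -pmulrn. Qed.

Lemma evalqXn n q : evalq ('X^n) q = (val q)%:R ^+ n.
Proof. by rewrite /evalq hornerXn rmorphXn /= -pmulrn. Qed.

Definition evalqE := (evalqD, evalqN, evalqM, evalqXn, evalqX, evalq1).

Section SmallestSubgroup.
Variable G : set fct.
Local Notation V := (smallest additive_subgroup G).

Lemma smallest_additive_subgroup : additive_subgroup V.
Proof.
split=> [|f g Vf Vg] W WG; first by case: WG => [[W0 _] _].
by have [[_ WB] _] := WG; exact: WB (Vf _ WG) (Vg _ WG).
Qed.

End SmallestSubgroup.

Section AdditiveSubgroup.
Variable V : set fct.
Hypothesis VG : additive_subgroup V.

Lemma subgroupN f : V f -> V (fun q => - f q).
Proof.
move=> Vf; have [V0 VB] := VG.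
have -> : (fun q => - f q) = (fun q => 0 - f q).
  by apply: funext => q; rewrite sub0r.
exact: VB.
Qed.

Lemma subgroupD f g : V f -> V g -> V (fun q => f q + g q).
Proof.
move=> Vf Vg.
have -> : (fun q => f q + g q) = (fun q => f q - - g q).
  by apply: funext => q; rewrite opprK.
exact: VG.2 _ _ Vf (subgroupN Vg).
Qed.

Lemma subgroup_sum J (s : seq J) (f : J -> fct) :
  (forall j, V (f j)) -> V (fun q => \sum_(j <- s) f j q).
Proof.
move=> Vf; elim: s => [|j s IHs].
  have -> : (fun q => \sum_(i <- [::]) f i q) = fun=> 0.
    by apply: funext => q; rewrite big_nil.
  by case: VG.
have -> : (fun q => \sum_(i <- j :: s) f i q) =
    (fun q => f j q + \sum_(i <- s) f i q).
  by apply: funext => q; rewrite big_cons.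
exact: subgroupD (Vf j) IHs.
Qed.
End AdditiveSubgroup.

Lemma SS_saturated : saturated_mult_system SS.
Proof.
split=> [|a b Sa Sb|a b Sab] W WG; have [[W1 WM Wd] _] := WG; first exact: W1.
  exact: WM (Sa _ WG) (Sb _ WG).
exact: Wd (Sab _ WG).
Qed.

Lemma SS1 : SS 1. Proof. by case: SS_saturated. Qed.
Lemma SSM a b : SS a -> SS b -> SS (a * b).
Proof. by case: SS_saturated => _ SM _; apply: SM. Qed.

Lemma SS_factors a b : SS (a * b) -> SS a /\ SS b.
Proof.
have [_ _ Sd] := SS_saturated => Sab; split; first exact: Sd Sab.
by apply: (Sd b a); rewrite mulrC.
Qed.

(** The product of the two is q^(n+1) - q, and [SS] is closed under divisors. *)
Lemma SS_sub_X n : (0 < n)%N -> SS 'X /\ SS ('X^n - 1).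
Proof.
move=> n_gt0; apply: SS_factors.
rewrite mulrBr mulr1 -exprS => W [_]; apply.
by exists n.+1.
Qed.

Lemma SSX : SS 'X. Proof. exact: (SS_sub_X (n := 1) isT).1. Qed.
Lemma SSXn1 n : (0 < n)%N -> SS ('X^n - 1). Proof. by case/SS_sub_X. Qed.
Lemma SSX1 : SS ('X - 1). Proof. exact: (@SSXn1 1). Qed.

Lemma SS_prod J (s : seq J) (f : J -> {poly int}) :
  (forall j, SS (f j)) -> SS (\prod_(j <- s) f j).
Proof. by move=> Sf; apply: big_ind => //; [apply: SS1|apply: SSM]. Qed.

Lemma SSXn n : SS ('X^n).
Proof.
by elim: n => [|n IHn]; rewrite ?exprS; [apply: SS1|apply: SSM SSX _].
Qed.

(** The polynomials that do not vanish at a given q form a saturated multiplicative system, and q^n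
    - q is not zero because q > 1. *)
Lemma SS_evalq_neq0 s q : SS s -> evalq s q != 0.
Proof.
move=> Ss; pose W := [set s | evalq s q != 0].
suff : W s by []; apply: Ss; split=> [|_ [n n_gt1 ->]].
  split=> [|a b|a b]; rewrite /W /= ?evalqE ?oner_eq0 // ?mulf_eq0 negb_or.
    by move=> -> ->.
  by case/andP.
rewrite /W /= !evalqE -natrX subr_eq0 eqr_nat gtn_eqF //.
have q_gt1 := primepower_gt1 q.
by rewrite -[X in (X < _)%N]expn1 (ltn_exp2l _ _ q_gt1).
Qed.

Lemma RR_poly p : RR (evalq p).
Proof.
exists p, 1; split; first exact: SS1.
by apply: funext => q; rewrite evalq1 divr1.
Qed.

Lemma RR_inv s : SS s -> RR (fun q => (evalq s q)^-1).
Proof.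
move=> Ss; exists 1, s; split=> //.
by apply: funext => q; rewrite evalq1 mul1r.
Qed.

Section Submodule.
Variable V : set fct.
Hypothesis VR : R_submodule V.

Lemma submoduleD f g : V f -> V g -> V (fun q => f q + g q).
Proof. by case: VR => _ VD _; apply: VD. Qed.

Lemma submoduleZ p f : V f -> V (fun q => evalq p q * f q).
Proof. by case: VR => _ _ VZ Vf; apply: VZ => //; apply: RR_poly. Qed.

Lemma submodule_div s f : SS s -> V f -> V (fun q => f q / evalq s q).
Proof.
case: VR => _ _ VZ Ss Vf.
have -> : (fun q => f q / evalq s q) = (fun q => (evalq s q)^-1 * f q).
  by apply: funext => q; rewrite mulrC.
exact: VZ (RR_inv Ss) Vf.
Qed.

Lemma submodule_cancel s f : SS s -> V (fun q => evalq s q * f q) -> V f.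
Proof.
move=> Ss /(submodule_div Ss); congr (V _); apply: funext => q.
by rewrite mulrAC divff ?mul1r // SS_evalq_neq0.
Qed.

Lemma submodule_additive : additive_subgroup V.
Proof.
split=> [|f g Vf Vg]; first by case: VR.
have -> : (fun q => f q - g q) = (fun q => f q + evalq (-1) q * g q).
  by apply: funext => q; rewrite evalqN evalq1 mulN1r.
exact/submoduleD/submoduleZ.
Qed.
End Submodule.

Lemma Graphs_star_submodule : R_submodule Graphs_star.
Proof.
split=> [|f g Vf Vg|r f Rr Vf] W WG; have [[W0 WD WZ] _] := WG; first exact: W0.
  exact: WD (Vf _ WG) (Vg _ WG).
exact: WZ Rr (Vf _ WG).
Qed.

(** * Counting the zeros of integral equations *)

Definition naff (I : finType) (T : seq (expr I)) (q : primepower) : nat :=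
  #|[pred x : {ffun I -> Fq q} | vanish T x]|.
Definition aff (I : finType) (T : seq (expr I)) : fct := fun q => (naff T q)%:R.

Lemma aff_point_count (I : finType) (T : seq (expr I)) :
  is_point_count (Aff T) (aff T).
Proof.
apply: is_point_count_Fq => q.
pose g (x : Aff T (Fq q)) : {ffun I -> Fq q} := [ffun i => sval x i].
have gE x : g x =1 sval x by move=> i; rewrite ffunE.
apply: (card_eq_encoding (g := g)) => [x y /ffunP xy|x|y].
- by apply: Aff_points_eq => i; rewrite -!gE.
- by rewrite inE /= (eq_vanish _ (gE x)); apply: (svalP x).
- rewrite inE /= => yT; exists (exist (fun x => vanish T x) (y : I -> Fq q) yT).
  by apply/ffunP => i; rewrite ffunE.
Qed.

Lemma Mot_plus_aff (I : finType) (T : seq (expr I)) : Mot_plus (aff T).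
Proof.
apply: sub_gen_smallest; exists (Aff T); last exact: aff_point_count.
exact: Aff_scheme_of_finite_type.
Qed.

(** Turns out to be [Mot_plus]; on these generators multiplication by q and membership in
    [Graphs_star] can be checked directly. *)
Definition aff_span : set fct :=
  smallest additive_subgroup [set f | exists (I : finType) (T : seq (expr I)), f =
    aff T].

Fixpoint rename I J (f : I -> J) (t : expr I) : expr J :=
  match t with
  | Var i => Var (f i)
  | Mone => Mone
  | Add t u => Add (rename f t) (rename f u)
  | Mul t u => Mul (rename f t) (rename f u)
  end.

Lemma ev_rename I J (f : I -> J) (R : comPzRingType) (x : J -> R) t :
  ev x (rename f t) = ev (x \o f) t.
Proof. by elim: t => //= [t -> u ->|t -> u ->]. Qed.

(** The variable [None] occurs in no equation, which amounts to a product with the affine line. *)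
Lemma naff_mulq (I : finType) (T : seq (expr I)) q :
  naff (map (rename Some) T) q = (val q * naff T q)%N.
Proof.
rewrite -card_Fq -cardX.
pose g (x : {ffun option I -> Fq q}) : Fq q * {ffun I -> Fq q} :=
  (x None, [ffun i => x (Some i)]).
have vE (x : {ffun option I -> Fq q}) : vanish (map (rename Some) T) x = vanish T
    (g x).2.
  rewrite (eq_vanish _ (y := x \o Some)) => [|i]; last by rewrite ffunE.
  by rewrite /vanish all_map; apply: eq_all => t /=; rewrite ev_rename.
apply: (card_pred_bij (g := g)) => [x y _ _ [xyN /ffunP xyS]|x|[a y]].
- by apply/ffunP=> -[i|] //; have := xyS i; rewrite !ffunE.
- by rewrite !inE vE.
rewrite !inE /= => yT; pose x := [ffun o => if o is Some i then y i else a].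
have gx : g x = (a, y).
  by congr (_, _); rewrite ?ffunE //; apply/ffunP=> i; rewrite !ffunE.
by exists x; rewrite // inE vE gx.
Qed.

Local Close Scope classical_set_scope.

(** * Hilbert's basis theorem *)

Section Ideals.
Variable R : comPzRingType.
Implicit Types (J S : set R) (s : seq R).

Definition is_ideal J :=
  [/\ J 0, forall a b, J a -> J b -> J (a + b) & forall c a, J a -> J (c * a)].

Definition gen S (a : R) := forall J, is_ideal J -> (forall x, S x -> J x) -> J a.

Lemma gen_ideal S : is_ideal (gen S).
Proof.
split=> [J [J0 _ _] _|a b Sa Sb J idJ SJ|c a Sa J idJ SJ] //; have [_ JD JM] := idJ.
  by apply: JD; [apply: Sa|apply: Sb].
by apply: JM; apply: Sa.
Qed.

Lemma gen_sub S x : S x -> gen S x. Proof. by move=> Sx J _; apply. Qed.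

Lemma gen_incl S S' : (forall x, S x -> gen S' x) -> forall a, gen S a -> gen S' a.
Proof. by move=> SS' a Sa; exact: (Sa _ (gen_ideal S') SS'). Qed.

Lemma idealN J a : is_ideal J -> J a -> J (- a).
Proof. by case=> _ _ JM Ja; rewrite -mulN1r; apply: JM. Qed.

Lemma idealB J a b : is_ideal J -> J a -> J b -> J (a - b).
Proof.
by move=> idJ Ja Jb; have [_ JD _] := idJ; apply: JD => //; apply: idealN.
Qed.
End Ideals.

Local Notation in_seq s := (fun x => x \in s).

Definition noetherian (R : comPzRingType) := forall J : set R, is_ideal J ->
  exists s : seq R, (forall x, x \in s -> J x) /\ (forall a, J a -> gen (in_seq s)
    a).

(** The elements lying in the ideal of some finite part of S form an ideal [J] containing S. Hence
    each of the finitely many generators of [gen S] needs only finitely many elements of S. *)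
Lemma noetherian_set (R : comPzRingType) (S : set R) : noetherian R ->
  exists s : seq R, (forall x, x \in s -> S x) /\ (forall a, S a -> gen (in_seq s)
    a).
Proof.
move=> /(_ _ (gen_ideal S))[t [tS St]].
pose J : set R := fun a => exists s : seq R, (forall x, x \in s -> S x) /\ gen
  (in_seq s) a.
have idJ : is_ideal J.
  split=> [|a b [s [sS sa]] [s' [sS' sb]]|c a [s [sS sa]]].
  - by exists [::]; split=> //; have [] := gen_ideal (in_seq ([::] : seq R)).
  - exists (s ++ s'); split=> [x|].
      by rewrite mem_cat => /orP[/sS|/sS'].
    have [_ gD _] := gen_ideal (in_seq (s ++ s')); apply: gD.
      by apply: gen_incl sa => x xs; apply: gen_sub; rewrite mem_cat xs.
    by apply: gen_incl sb => x xs; apply: gen_sub; rewrite mem_cat xs orbT.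
  - by exists s; split=> //; have [_ _ gM] := gen_ideal (in_seq s); apply: gM.
have JS x : S x -> J x.
  move=> Sx; exists [:: x]; split=> [y|]; first by rewrite inE => /eqP->.
  by apply: gen_sub; rewrite inE.
have tJ x : x \in t -> J x by move/tS; apply.
have [s [sS ts]] : exists s : seq R, (forall x, x \in s -> S x) /\
    (forall x, x \in t -> gen (in_seq s) x).
  elim: t tJ {tS St} => [|x t IH] tJ; first by exists [::].
  have [|s [sS ts]] := IH; first by move=> y yt; apply: tJ; rewrite inE yt orbT.
  have [s' [sS' xs']] : J x by apply: tJ; rewrite inE eqxx.
  exists (s' ++ s); split=> [y|y]; first by rewrite mem_cat => /orP[/sS'|/sS].
  rewrite inE => /orP[/eqP->|/ts gy]; [apply: gen_incl xs'|apply: gen_incl gy];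
    move=> z /= zs; apply: gen_sub => /=.
    by rewrite mem_cat zs.
  by rewrite mem_cat zs orbT.
exists s; split=> // a Sa; exact: (gen_incl ts (St a (gen_sub Sa))).
Qed.

Lemma noetherian_int : noetherian int.
Proof.
move=> J idJ; have [J0 JD JM] := idJ.
have [[a [Ja nz_a]]|no_nz] := pselect (exists a, J a /\ a != 0); last first.
  exists [::]; split=> // a Ja; suff -> : a = 0 by have [] := gen_ideal (in_seq
    ([::] : seq int)).
  by apply: contrapT => /eqP nz_a; apply: no_nz; exists a.
(* By Euclidean division, a nonzero element of least absolute value divides all elements of the
   ideal. *)
pose P n := `[< exists b : int, [/\ J b, b != 0 & `|b|%N = n] >].
have exP : exists n, P n by exists `|a|%N; apply/asboolP; exists a.
have [_ /asboolP[b [Jb nz_b <-]] minb] := ex_minnP exP.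
exists [:: b]; split=> [x|c Jc]; first by rewrite inE => /eqP->.
have [g0 gD gM] := gen_ideal (in_seq [:: b]).
have gb : gen (in_seq [:: b]) b by apply: gen_sub; rewrite inE.
suff : (c %% b)%Z = 0 by move=> r0; rewrite (divz_eq c b) r0 addr0; apply: gM.
apply: contrapT => /eqP nz_r.
have /minb : P `|(c %% b)%Z|%N.
  apply/asboolP; exists (c %% b)%Z; split=> //.
  have -> : (c %% b)%Z = c - (c %/ b)%Z * b by rewrite {2}(divz_eq c b); ring.
  by apply: idealB => //; apply: JM.
rewrite leqNgt -ltz_nat !abszE => /negP; apply.
by rewrite ger0_norm ?modz_ge0 // ltz_mod.
Qed.

Section Hilbert.
Variable R : comNzRingType.
Hypothesis R_noeth : noetherian R.
Variable I : set {poly R}.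
Hypothesis idI : is_ideal I.

(** The second component is a nominal degree, at least the true one where this is used. The
    coefficient there may be zero, so that these coefficients are closed under addition. *)
Definition lead (p : {poly R} * nat) : R := p.1`_p.2.

Lemma ideal_scale c p : I p -> I (c *: p).
Proof. by case: idI => _ _ IM Ip; rewrite -mul_polyC; apply: IM. Qed.

Lemma gen_scale (s : seq {poly R}) c p : gen (in_seq s) p -> gen (in_seq s) (c *:
    p).
Proof.
by case: (gen_ideal (in_seq s)) => _ _ gM gp; rewrite -mul_polyC; apply: gM.
Qed.

(* Subtracting an element of the ideal of s with the same coefficient in degree m
   lowers the size. *)
Lemma gen_reduce (s : seq {poly R}) m (f h : {poly R}) :
  (forall g, I g -> (size g <= m)%N -> gen (in_seq s) g) ->
  (forall x, x \in s -> I x) ->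
  I f -> (size f <= m.+1)%N -> gen (in_seq s) h -> (size h <= m.+1)%N ->
  h`_m = f`_m -> gen (in_seq s) f.
Proof.
move=> IH sI If szf gh szh hf; have [_ gD _] := gen_ideal (in_seq s).
rewrite -(subrK h f); apply: gD => //; apply: IH.
  by apply: idealB => //; apply: gh.
apply/leq_sizeP => j; rewrite leq_eqVlt => /orP[/eqP<-|lt_mj].
  by rewrite coefB hf subrr.
by rewrite coefB !nth_default ?subrr // (leq_trans _ lt_mj).
Qed.

(** The coefficients in nominal degrees from D form an ideal of R: for a sum, both polynomials are
    first shifted by powers of X to the larger degree. D = {m} serves degree m alone, the full D
    serves all degrees at once. *)
Lemma lifts (D : set nat) :
  (forall d d', D d -> D d' -> D (maxn d d')) -> (exists d, D d) ->
  exists s : seq ({poly R} * nat),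
    (forall p, p \in s -> [/\ I p.1, D p.2 & (size p.1 <= p.2.+1)%N]) /\
    forall f d, I f -> D d -> (size f <= d.+1)%N ->
      gen (in_seq (map lead s)) f`_d.
Proof.
move=> Dmax [d0 Dd0]; have [I0 ID IM] := idI.
pose L : set R := fun a => exists p : {poly R} * nat,
  [/\ I p.1, D p.2, (size p.1 <= p.2.+1)%N & lead p = a].
have shift f d d' : I f -> (d <= d')%N -> (size f <= d.+1)%N ->
    [/\ I (f * 'X^(d' - d)), (size (f * 'X^(d' - d))%R <= d'.+1)%N
      & (f * 'X^(d' - d))`_d' = f`_d].
  move=> If le_d szf; split; first by rewrite mulrC; apply: IM.
    apply: leq_trans (size_polyMleq _ _) _; rewrite size_polyXn; lia.
  by rewrite coefMXn ltnNge leq_subr /= subKn.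
have [|t [tL Lt]] := R_noeth (J := L).
  split.
  - by exists (0, d0); split; rewrite /lead /= ?size_poly0 ?coef0.
  - move=> a b [[f d] [/= If Dd szf <-]] [[g e] [/= Ig De szg <-]];
    rewrite /lead /=.
    have [If' szf' <-] := shift _ _ _ If (leq_maxl d e) szf.
    have [Ig' szg' <-] := shift _ _ _ Ig (leq_maxr d e) szg.
    eexists (_ + _, maxn d e); split=> /=;
      [exact: ID If' Ig'|exact: Dmax| |by rewrite /lead coefD].
    by rewrite (leq_trans (size_polyD _ _)) // geq_max szf' szg'.
  - move=> c _ [[f d] [/= If Dd szf <-]]; exists (c *: f, d); split=> //=.
    + exact: ideal_scale.
    + exact: leq_trans (size_scale_leq _ _) szf.
    + by rewrite /lead coefZ.
have /choice[l lP] (a : R) : exists p : {poly R} * nat,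
    a \in t -> [/\ I p.1, D p.2, (size p.1 <= p.2.+1)%N & lead p = a].
  have [/tL[p pP]|nta] := boolP (a \in t); first by exists p.
  by exists (0, 0%N).
exists (map l t); split=> [_ /mapP[a /lP[] ? ? ? _ ->] //|f d If Dd szf].
have : gen (in_seq t) f`_d by apply: Lt; exists (f, d).
apply: gen_incl => a ta; apply: gen_sub; have [_ _ _ <-] := lP a ta.
by apply/mapP; exists (l a) => //; apply: map_f.
Qed.

(** Powers of X bring all the generators to degree m, where the combination giving a on leading
    coefficients gives h on polynomials. *)
Lemma lead_realized (s : seq ({poly R} * nat)) (S : seq {poly R}) m a :
  (forall p, p \in s -> [/\ p.1 \in S, (p.2 <= m)%N & (size p.1 <= p.2.+1)%N]) ->
  gen (in_seq (map lead s)) a ->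
  exists h, [/\ gen (in_seq S) h, (size h <= m.+1)%N & h`_m = a].
Proof.
have [g0 gD gM] := gen_ideal (in_seq S).
move=> sP /(_ (fun a => exists h, [/\ gen (in_seq S) h, (size h <= m.+1)%N & h`_m
  = a])).
apply; first split.
- by exists 0; rewrite size_poly0 coef0.
- move=> b c [f [gf szf <-]] [h [gh szh <-]]; exists (f + h); split;
  first exact: gD.
    by rewrite (leq_trans (size_polyD _ _)) // geq_max szf szh.
  by rewrite coefD.
- move=> c b [f [gf szf <-]]; exists (c *: f); split; first exact: gen_scale.
    exact: leq_trans (size_scale_leq _ _) szf.
  by rewrite coefZ.
move=> _ /mapP[[f d] /sP[fS le_d szf] ->]; exists (f * 'X^(m - d)); split.
- by rewrite mulrC; apply: gM; apply: gen_sub.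
- apply: leq_trans (size_polyMleq _ _) _; rewrite size_polyXn addnS /=.
  by apply: leq_trans (leq_add szf (leqnn _)) _; rewrite addSn subnKC.
- by rewrite coefMXn ltnNge leq_subr /= subKn.
Qed.

(** Each step adds generators realizing all coefficients in degree m, which reduces f to smaller
    size. *)
Lemma gen_bounded m : exists s : seq {poly R}, (forall x, x \in s -> I x) /\
  forall f, I f -> (size f <= m)%N -> gen (in_seq s) f.
Proof.
elim: m => [|m [s [sI sG]]].
  exists [::]; split=> // f _; rewrite leqn0 size_poly_eq0 => /eqP->.
  by have [] := gen_ideal (in_seq ([::] : seq {poly R})).
have [||ls [lsI lsG]] := @lifts [set m]%classic.
- by move=> d d' -> ->; rewrite maxnn.
- by exists m.
pose S := s ++ map fst ls.
have SI x : x \in S -> I x.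
  by rewrite mem_cat => /orP[/sI|/mapP[p /lsI[] ? _ _ ->]].
exists S; split=> // f If szf.
have [|h [gh szh hf]] := @lead_realized ls S m _ _ (lsG f m If erefl szf).
  move=> p pls; have [_ /= Dp szp] := lsI p pls; split=> //.
    by rewrite mem_cat map_f ?orbT.
  by rewrite Dp.
apply: gen_reduce gh szh hf => // g Ig szg.
by apply: gen_incl (sG g Ig szg) => x xs; apply: gen_sub; rewrite mem_cat xs.
Qed.
End Hilbert.

(** Let D be the largest nominal degree among lifts of all leading coefficients. Polynomials of size
    above D are reduced by shifts of these lifts; [gen_bounded] settles the others. *)
Theorem noetherian_poly (R : comNzRingType) : noetherian R -> noetherian {poly R}.
Proof.
move=> R_noeth I idI.
have [||ls [lsI lsG]] := lifts R_noeth idI (D := setT) => //; first by exists 0%N.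
pose D := (\max_(p <- ls) p.2)%N.
have [s [sI sG]] := gen_bounded R_noeth idI D.
pose S := s ++ map fst ls.
have SI x : x \in S -> I x.
  by rewrite mem_cat => /orP[/sI|/mapP[p /lsI[] ? _ _ ->]].
exists S; split=> // f; elim: {f}(size f) {-2}f (leqnn (size f)) => [|m IH] f szf
  If.
  move: szf; rewrite leqn0 size_poly_eq0 => /eqP->.
  by have [] := gen_ideal (in_seq S).
have [le_mD|lt_Dm] := leqP m.+1 D.
  apply: gen_incl (sG f If (leq_trans szf le_mD)) => x xs.
  by apply: gen_sub; rewrite mem_cat xs.
have [|h [gh szh hf]] := @lead_realized _ ls S m _ _ (lsG f m If Logic.I szf).
  move=> p pls; have [_ _ szp] := lsI p pls; split=> //.
    by rewrite mem_cat map_f ?orbT.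
  by rewrite -ltnS (leq_trans _ lt_Dm) // ltnS; apply: leq_bigmax_seq.
by apply: (gen_reduce idI) gh szh hf => // g Ig szg; apply: IH.
Qed.

(** * Stratification of a scheme by affine zero sets *)

(** Z[X_1, ..., X_n], iterated so that the basis theorem applies one variable at a time. *)
Fixpoint ipoly (n : nat) : comNzRingType :=
  if n is m.+1 then {poly ipoly m} : comNzRingType else int.

Lemma noetherian_ipoly n : noetherian (ipoly n).
Proof.
by elim: n => [|n IHn]; [apply: noetherian_int|apply: noetherian_poly].
Qed.

Lemma ipoly_eval n : exists X : 'I_n -> ipoly n,
  forall (R : comNzRingType) (y : 'I_n -> R),
  exists h : {rmorphism ipoly n -> R}, forall i, h (X i) = y i.
Proof.
elim: n => [|n [X XP]].
  exists (fun=> 0) => R y; exists (intr : {rmorphism int -> R}).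
  by case.
exists (fun i => if unlift ord_max i is Some j then (X j)%:P else 'X) => R y.
have [h hP] := XP R (fun j => y (lift ord_max j)).
have cfu : commr_rmorph h (y ord_max) by move=> a; apply: mulrC.
exists (horner_morph cfu : {rmorphism {poly ipoly n} -> R}) => i.
case: unliftP => [j|] -> /=; first by rewrite horner_morphC hP.
by rewrite horner_morphX.
Qed.

(** The ideal of Z[X] generated by S is generated by finitely many members of S; it is killed by
    evaluation at a common zero of these, the kernel of evaluation being an ideal. *)
Lemma expr_noetherian (J : finType) (S : set (expr J)) :
  exists T : seq (expr J), (forall t, t \in T -> S t) /\
    forall (R : comNzRingType) (y : J -> R), vanish T y ->
    forall t, S t -> ev y t = 0.
Proof.
have [X XP] := ipoly_eval #|J|; pose X' (j : J) := X (enum_rank j).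
have [s [sS Ss]] := noetherian_set (ev X' @` S)%classic (@noetherian_ipoly #|J|).
have /choice[l lP] (a : ipoly #|J|) : exists t, a \in s -> S t /\ ev X' t = a.
  have [/sS[t St <-]|nsa] := boolP (a \in s); first by exists t.
  by exists Mone.
exists (map l s); split=> [t /mapP[a /lP[Sl _] ->] //|R y /vanishP yT t St].
have [h hP] := XP R (y \o enum_val).
have hev u : h (ev X' u) = ev y u.
  by rewrite ev_rmorph; apply: eq_ev => j; rewrite /= hP /= enum_rankK.
have /(_ (fun a => h a = 0)) : gen (in_seq s) (ev X' t) by apply: Ss; exists t.
rewrite -hev; apply=> [|a sa].
  by split=> [|a b|c a]; rewrite ?rmorph0 // ?rmorphD ?rmorphM /= => ->;
    rewrite ?mulr0 // add0r.
have [_ <-] := lP a sa; rewrite hev; apply: yT; exact: map_f.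
Qed.

Lemma finitely_generated_expr (A : comPzRingType) : finitely_generated A ->
  exists (J : finType) (e : J -> A), forall a, exists t, ev e t = a.
Proof.
case=> E [/finite_seqP[s ->] genE].
pose e (i : 'I_(size s)) := s`_i; exists 'I_(size s), e => a.
have /(_ (fun a => exists t, ev e t = a)) : smallest (@subring A) [set` s]%classic
    a.
  by rewrite genE.
apply; split=> [|x /= xs]; last first.
  have lt_x : (index x s < size s)%N by rewrite index_mem.
  by exists (Var (Ordinal lt_x)); rewrite /= /e nth_index.
split=> [|_ _ [t <-] [u <-]|_ _ [t <-] [u <-]].
- by exists One; rewrite ev_One.
- by exists (Add t (Opp u)); rewrite [LHS]/= mulN1r.
- by exists (Mul t u).
Qed.

Lemma eq_fmap (X : zfunctor) (R S : comPzRingType) (f g : {rmorphism R -> S}) :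
  f =1 g -> @fmap X _ _ f =1 fmap g.
Proof.
move=> fg x; rewrite (@fmap_comp X _ _ _ g idfun f) => [|y]; last by rewrite fg.
by rewrite /= fmap_id.
Qed.

Section SchemeStratification.
Variables (X : zfunctor) (n : nat) (A : 'I_n -> comPzRingType) (u : forall i, X (A
  i)).
Hypotheses (uO : forall i, open_chart (u i))
  (uC : forall (K : fieldType) (x : X K), exists i, in_chart (u i) x).
Variables (J : 'I_n -> finType) (e : forall i, J i -> A i).
Hypothesis eG : forall i a, exists t, ev (@e i) t = a.
Variable D : forall i j : 'I_n, set (A i).
Hypothesis DP : forall i j (R : comPzRingType) (f : {rmorphism A i -> R}),
  in_chart (u j) (fmap f (u i)) <-> unit_ideal (f @` @D i j)%classic.
Variable T : forall i, seq (expr (J i)).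
(* T i cuts out the part of the i-th chart outside the previous charts. *)
Hypothesis TS : forall i t, t \in T i ->
  ev (@e i) t = 0 \/ exists j : 'I_n, (j < i)%N /\ @D i j (ev (@e i) t).
Hypothesis TE : forall i (R : comNzRingType) (y : J i -> R), vanish (T i) y ->
  forall t, ev (@e i) t = 0 \/ (exists j : 'I_n, (j < i)%N /\ @D i j (ev (@e i)
    t)) ->
  ev y t = 0.

Variable F : finFieldType.
Local Notation chart_pt := {i : 'I_n & {ffun J i -> F}}.

(** A code z names a chart through x and the values of the generators [e] at x. A point has one code
    for each chart containing it; [stratum] keeps the one of the first chart. *)
Definition represents (x : X F) (z : chart_pt) :=
  exists f : {rmorphism A (tag z) -> F},
    (forall a, f (e a) = tagged z a) /\ fmap f (u (tag z)) = x.

Definition stratum : pred chart_pt := [pred z : chart_pt | vanish (T (tag z))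
    (tagged z)].

Lemma represents_exists x : exists z, z \in stratum /\ represents x z.
Proof.
pose P k := `[< exists i : 'I_n, val i = k /\ in_chart (u i) x >].
have exP : exists k, P k.
  by have [i ui] := uC x; exists (val i); apply/asboolP; exists i.
have [_ /asboolP[i [<- [f Dx]]] mini] := ex_minnP exP.
exists (Tagged (fun i => {ffun J i -> F}) [ffun a => f (e a)]); split; last first.
  by exists f; split=> // a; rewrite ffunE.
rewrite inE /=; apply/vanishP=> t Tt.
rewrite (eq_ev (y := f \o @e i)) => [|a]; last by rewrite ffunE.
rewrite -ev_rmorph; have [->|[j [lt_ji Dt]]] := TS Tt; first by rewrite rmorph0.
(* A nonzero value in the field generates the unit ideal, which would put x in the earlier chart
   j. *)
apply: contrapT => /eqP nz; have : P j.
  apply/asboolP; exists j; split=> //; rewrite -Dx; apply/DP.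
  exists 1%N, (fun=> (f (ev (@e i) t))^-1), (fun=> f (ev (@e i) t)).
  by split=> [_|]; [exists (ev (@e i) t)|rewrite big_ord1 mulVf].
by move/mini; rewrite leqNgt lt_ji.
Qed.

Lemma stratum_represents z : z \in stratum -> exists x, represents x z.
Proof.
case: z => i y; rewrite inE /= => yT.
have /choice[l lP] : forall a : A i, exists t, ev (@e i) t = a := @eG i.
(* By [TE] every relation between the generators holds at y, so evaluating at y any expression for a
   is a well defined ring morphism on A_i. *)
have wd t v : ev (@e i) t = ev (@e i) v -> ev y t = ev y v.
  move=> tv; apply/eqP; rewrite -subr_eq0 -mulN1r; apply/eqP.
  by apply: (TE yT (t := Add t (Opp v))); left; rewrite /= tv mulN1r subrr.
pose f a := ev y (l a).
have fB : zmod_morphism f.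
  move=> a b; rewrite /f (wd _ (Add (l a) (Opp (l b)))) /= ?mulN1r //.
  by rewrite !lP.
have fM : monoid_morphism f.
  split=> [|a b]; first by rewrite /f (wd _ One) ?ev_One // lP.
  by rewrite /f (wd _ (Mul (l a) (l b))) //= !lP.
pose f1 := GRing.isZmodMorphism.Build (A i) F f fB.
pose f2 := GRing.isMonoidMorphism.Build (A i) F f fM.
pose fr : {rmorphism A i -> F} := HB.pack f f1 f2.
exists (fmap fr (u i)), fr; split=> // a.
by rewrite [LHS](wd _ (Var a)) // lP.
Qed.

Lemma rmorph_ext i (f g : {rmorphism A i -> F}) : (forall a, f (e a) = g (e a)) ->
    f =1 g.
Proof.
move=> fg a; have [t <-] := eG a; rewrite !ev_rmorph.
by apply: eq_ev => b /=; apply: fg.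
Qed.

Lemma represents_fun x x' z : represents x z -> represents x' z -> x = x'.
Proof.
case=> f [fE <-] [g [gE <-]]; apply: eq_fmap; apply: rmorph_ext => a.
by rewrite fE gE.
Qed.

(** In an earlier chart through x the elements of [D] would generate the unit ideal at x, yet all of
    them vanish on the stratum of z. *)
Lemma represents_min x z z' : z \in stratum -> represents x z -> represents x z' ->
  (tag z <= tag z')%N.
Proof.
rewrite inE /= => zT [f [fE Dx]] [g [_ Dx']]; rewrite leqNgt; apply/negP=> lt_z'.
have : in_chart (u (tag z')) (fmap f (u (tag z))) by exists g; rewrite Dx' Dx.
case/DP=> m [c [a [aD]]]; rewrite big1 => [/esym/eqP|k _];
  first by rewrite oner_eq0.
have [b Db <-] := aD k; have [t Dt] := eG b; rewrite -Dt ev_rmorph.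
rewrite (eq_ev (y := tagged z)) => [|j]; last by rewrite /= fE.
rewrite (TE zT) ?mulr0 //; right.
by exists (tag z'); rewrite Dt.
Qed.

Lemma represents_inj x z z' : z \in stratum -> z' \in stratum ->
  represents x z -> represents x z' -> z = z'.
Proof.
move=> zT z'T xz xz'.
have : tag z = tag z'.
  by apply/val_inj/anti_leq; rewrite (represents_min zT xz xz') (represents_min
    z'T xz' xz).
case: z z' {zT z'T} xz xz' => [i y] [i' y'] /= xz xz' Di; case: i' / Di y' xz'.
move=> y' [g [gE Dx']]; case: xz => f [fE Dx]; congr existT; apply/ffunP=> a.
have [mono _] := uO i.
by rewrite -[y a]fE -[y' a]gE; apply: mono; rewrite Dx Dx'.
Qed.

Lemma card_scheme : ([set: X F] #= `I_#|stratum|)%card.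
Proof.
have /choice[g gP] := represents_exists.
apply: (card_eq_encoding (g := g)) => [x x' gx|x|z zT].
- have [_ rx] := gP x; have [_ rx'] := gP x'.
  by rewrite gx in rx; apply: represents_fun rx rx'.
- by have [] := gP x.
- have [x rx] := stratum_represents zT; exists x.
  by have [gT rg] := gP x; apply: represents_inj gT zT rg rx.
Qed.

End SchemeStratification.

Lemma scheme_aff_span (X : zfunctor) f :
  scheme_of_finite_type X -> is_point_count X f -> aff_span f.
Proof.
case=> _ [n [A [u [uF uO uC]]]] Xf.
pose gens i := cid (finitely_generated_expr (uF i)).
pose J i : finType := sval (gens i).
pose e i : J i -> A i := sval (cid (svalP (gens i))).
have eG i a : exists t, ev (@e i) t = a := svalP (cid (svalP (gens i))) a.
pose opens i j := cid ((uO j).2 (A i) (u i)).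
pose D i j : set (A i) := sval (opens i j).
have DP i j (R : comPzRingType) (h : {rmorphism A i -> R}) :
    in_chart (u j) (fmap h (u i)) <-> unit_ideal (h @` D i j)%classic.
  exact: (svalP (opens i j)).
pose S i : set (expr (J i)) := fun t => ev (@e i) t = 0 \/
  exists j : 'I_n, (j < i)%N /\ D i j (ev (@e i) t).
pose eqns i := cid (expr_noetherian (S i)).
pose T i : seq (expr (J i)) := sval (eqns i).
have TS i t : t \in T i -> S i t by case: (svalP (eqns i)) => + _; apply.
have TE i (R : comNzRingType) (y : J i -> R) : vanish (T i) y ->
    forall t, S i t -> ev y t = 0.
  by case: (svalP (eqns i)) => _; apply.
have cX q := card_scheme uO uC eG DP TS TE (Fq q).
rewrite (is_point_count_inv cX Xf).
have -> : (fun q => #|stratum T (F := Fq q)|%:R : rat) = (fun q => \sum_i aff (T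
    i) q).
  apply: funext => q; rewrite -natr_sum; congr _%:R; rewrite /naff.
  under [RHS]eq_bigr do rewrite -sum1_card.
  by rewrite sig_big_dep -sum1_card; apply: eq_bigl => -[i y]; rewrite !inE.
apply: (subgroup_sum (smallest_additive_subgroup _) _ (f := fun i => aff (T i)))
  => i.
by apply: sub_gen_smallest; exists (J i), (T i).
Qed.

(** * Symmetric matrices by rank *)

Lemma card_pair_sum (A B : finType) (P : pred (A * B)) :
  #|P| = (\sum_a #|[pred b | P (a, b)]|)%N.
Proof.
rewrite -sum1_card; under [RHS]eq_bigr do rewrite -sum1_card.
by rewrite pair_big_dep; apply: eq_bigl => -[a b].
Qed.

Lemma card_rV_sub (F : finFieldType) m n (A : 'M[F]_(m, n)) :
  #|[pred u : 'rV[F]_n | (u <= A)%MS]| = (#|F| ^ \rank A)%N.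
Proof. by rewrite -card_rowg; apply: eq_card => u; rewrite mem_rowg. Qed.

(** The row space of A meets the line of u trivially. *)
Lemma mxrank_col_rV (F : fieldType) m n (A : 'M[F]_(m, n)) (u : 'rV_n) :
  ~~ (u <= A)%MS -> \rank (col_mx A u) = (\rank A).+1.
Proof.
move=> nuA; have nzu : u != 0 by apply: contraNneq nuA => ->; rewrite sub0mx.
have := mxrank_sum_cap A u; rewrite addsmxE rank_rV nzu [(\rank A + _)%N]addn1.
suff -> : \rank (A :&: u)%MS = 0%N by rewrite addn0.
have [le_rk eq_rk] := mxrank_leqif_sup (capmxSr A u).
move: le_rk eq_rk; rewrite rank_rV nzu leq_eqVlt ltnS leqn0.
case: eqP => [_ _|_ /eqP -> //] /esym /submx_trans /(_ (capmxSl _ _)).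
by rewrite (negPf nuA).
Qed.

(** If u = xA, symmetric elimination leaves A and the Schur complement d - x u^T, with x given by
    the pseudo-inverse. Otherwise (u d) is outside the row space of (A u^T), and u^T is outside the
    column space of A. *)
Lemma mxrank_bordered (F : fieldType) n (A : 'M[F]_n) (u : 'rV_n) (d : 'M_1) :
  A^T = A ->
  \rank (block_mx A u^T u d) =
    if (u <= A)%MS then (\rank A + (d != u *m pinvmx A *m u^T))%N
    else (\rank A).+2.
Proof.
move=> symA; case: ifPn => [uA|nuA].
  set x := u *m pinvmx A; have xA : x *m A = u by apply: mulmxKpV.
  have Axt : A *m x^T = u^T by rewrite -{1}symA -trmx_mul xA.
  have -> : block_mx A u^T u d = block_mx 1%:M 0 x 1%:M *m
      block_mx A 0 0 (d - x *m u^T) *m block_mx 1%:M x^T 0 1%:M.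
    rewrite !mulmx_block !(mul1mx, mul0mx, mulmx0, mulmx1, addr0, add0r).
    have uxt : u *m x^T = x *m u^T by rewrite -{1}xA -mulmxA Axt.
    rewrite xA; congr block_mx; first exact: esym.
    by rewrite uxt addrC subrK.
  have ux : block_mx 1%:M 0 x 1%:M \in unitmx by rewrite unitmxE det_lblock !det1
      mulr1 unitr1.
  have uxt : block_mx 1%:M x^T 0 1%:M \in unitmx by rewrite unitmxE det_ublock
      !det1 mulr1 unitr1.
  rewrite mxrankMfree ?row_free_unit // eqmxMfull ?row_full_unit //.
  by rewrite rank_diag_block_mx rank_rV subr_eq0.
rewrite -[block_mx _ _ _ _]/(col_mx (row_mx A u^T) (row_mx u d)) mxrank_col_rV.
  by rewrite -mxrank_tr tr_row_mx trmxK symA mxrank_col_rV.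
apply: contra nuA => /submxP[D /eqP]; rewrite mul_mx_row.
by case/eqP/eq_row_mx=> -> _; apply: submxMl.
Qed.

(** Bordering raises the rank by 0, 1 or 2: with u in the row space, d is forced or avoids one
    value; with u outside it, d is free. *)
Lemma card_bordered_rank (F : finFieldType) n (A : 'M[F]_n) r :
  A^T = A ->
  #|[pred ud : 'rV[F]_n * 'M[F]_1 | \rank (block_mx A ud.1^T ud.1 ud.2) == r.+2]| =
    ((\rank A == r.+2) * #|F| ^ r.+2 + (\rank A == r.+1) * (#|F| ^ r.+1 * (#|F| -
      1))
     + (\rank A == r) * ((#|F| ^ n - #|F| ^ r) * #|F|))%N.
Proof.
move=> symA; rewrite card_pair_sum /=.
pose a := ((\rank A == r.+2) + (\rank A == r.+1) * (#|F| - 1))%N.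
pose b := ((\rank A == r) * #|F|)%N.
have cM1 : #|{: 'M[F]_1}| = #|F| by rewrite card_mx muln1.
have cE u : #|[pred d : 'M[F]_1 | \rank (block_mx A u^T u d) == r.+2]| =
    if (u <= A)%MS then a else b.
  transitivity #|[pred d : 'M[F]_1 | (if (u <= A)%MS
      then (\rank A + (d != u *m pinvmx A *m u^T))%N else (\rank A).+2) == r.+2]|.
    by apply: eq_card => d; rewrite !inE mxrank_bordered.
  rewrite /a /b; case: ifP => uA; last first.
    have [rA|rA] := eqVneq (\rank A) r; last by rewrite /= mul0n eq_card0 // => d;
        rewrite !inE /=; lia.
    by rewrite /= mul1n -cM1; apply: eq_card => d; rewrite !inE /=; lia.
  set v := _ *m _ *m _.
  have [rA|rA2] := eqVneq (\rank A) r.+2.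
    rewrite rA (_ : r.+2 == r.+1 = false) /= ?mul0n ?addn0; last by lia.
    rewrite -[RHS](card1 v); apply: eq_card => d.
    by rewrite !inE; case: (d == v) => /=; lia.
  have [rA|rA1] := eqVneq (\rank A) r.+1.
    rewrite /= mul1n add0n -cM1 subn1 -[RHS](cardC1 v); apply: eq_card => d.
    by rewrite !inE rA; case: (d == v) => /=; lia.
  rewrite /= mul0n eq_card0 // => d; rewrite !inE /=.
  by move: rA1 rA2; case: (d != v); lia.
under eq_bigr do rewrite cE.
rewrite (bigID (fun u : 'rV[F]_n => (u <= A)%MS)) /=.
under eq_bigr => u -> do [].
under [X in (_ + X)%N]eq_bigr => u /negPf-> do [].
rewrite !sum_nat_const card_rV_sub.
have -> : #|[pred u : 'rV[F]_n | ~~ (u <= A)%MS]| = (#|F| ^ n - #|F| ^ \rank A)%N.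
  have := cardC [pred u : 'rV[F]_n | (u <= A)%MS].
  by rewrite card_rV_sub card_mx mul1n => <-; rewrite addKn; apply: eq_card.
rewrite /a /b.
have E2 : (r.+2 == r.+1) = false by lia.
have E3 : (r.+2 == r) = false by lia.
have E4 : (r.+1 == r) = false by lia.
have simp := (mul0n, muln0, mul1n, muln1, add0n, addn0, mulnA).
have [->|n2] := eqVneq (\rank A) r.+2; first by rewrite E2 E3 /= !simp.
have [->|n1] := eqVneq (\rank A) r.+1; first by rewrite E4 /= !simp.
by have [->|n0] := eqVneq (\rank A) r; rewrite /= !simp.
Qed.

Definition zpat n (e : rel 'I_n) (F : finFieldType) (M : 'M[F]_n) : bool :=
  (M^T == M) && [forall i, forall j, e i j ==> (M i j == 0)].

Lemma zpatP n (e : rel 'I_n) (F : finFieldType) (M : 'M[F]_n) :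
  reflect (M^T = M /\ forall i j, e i j -> M i j = 0) (zpat e M).
Proof.
apply: (iffP andP) => -[/eqP symM zM]; split=> //.
  by move=> i j eij; have /forallP/(_ i)/forallP/(_ j)/implyP/(_ eij)/eqP := zM.
by apply/forallP=> i; apply/forallP=> j; apply/implyP=> /zM/eqP.
Qed.

Definition isolate n (e : rel 'I_n) : rel 'I_(n + 1) := fun i j =>
  match fintype.split i, fintype.split j with inl a, inl b => e a b | _, _ =>
    false end.

Lemma isolate_sym n (e : rel 'I_n) : symmetric e -> symmetric (isolate e).
Proof.
by move=> se i j; rewrite /isolate; case: (fintype.split i) (fintype.split j) =>
  [a|a] [b|b].
Qed.

Lemma isolate_irr n (e : rel 'I_n) : irreflexive e -> irreflexive (isolate e).
Proof. by move=> ie i; rewrite /isolate; case: (fintype.split i). Qed.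

Lemma zpat_block n (e : rel 'I_n) (F : finFieldType) (A : 'M[F]_n) u v (d : 'M_1) :
  zpat (isolate e) (block_mx A u v d) = zpat e A && (v^T == u).
Proof.
apply/zpatP/andP => [[symM zM]|[/zpatP[symA zA] /eqP Du]].
  have /eq_block_mx[symA Du _ _] : block_mx A^T v^T u^T d^T = block_mx A u v d.
    by rewrite -tr_block_mx.
  split; last exact/eqP.
  apply/zpatP; split=> // i j eij; have := zM (lshift 1 i) (lshift 1 j).
  by rewrite block_mxEul; apply; rewrite /isolate !(unsplitK (inl _)).
split; first by rewrite tr_block_mx symA -Du trmxK [d]mx11_scalar tr_scalar_mx.
move=> i j; rewrite /isolate -[i]splitK -[j]splitK !unsplitK.
case: (fintype.split i) (fintype.split j) => [a|a] [b|b] //= /zA.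
by rewrite block_mxEul.
Qed.

Definition nrk n (e : rel 'I_n) (s : nat) (q : primepower) : nat :=
  #|[pred M : 'M[Fq q]_n | zpat e M && (\rank M == s)]|.

Lemma nrk_isolate n (e : rel 'I_n) r q :
  nrk (isolate e) r.+2 q =
    (val q ^ r.+2 * nrk e r.+2 q + val q ^ r.+1 * (val q - 1) * nrk e r.+1 q
     + (val q ^ n - val q ^ r) * val q * nrk e r q)%N.
Proof.
transitivity #|[pred x : 'M[Fq q]_n * ('rV_n * 'M_1) |
    zpat e x.1 && (\rank (block_mx x.1 x.2.1^T x.2.1 x.2.2) == r.+2)]|.
  pose g (M : 'M[Fq q]_(n + 1)) : 'M[Fq q]_n * ('rV[Fq q]_n * 'M[Fq q]_1) :=
    (ulsubmx M, (dlsubmx M, drsubmx M)).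
  have gK (M : 'M[Fq q]_(n + 1)) : zpat (isolate e) M ->
      block_mx (g M).1 (g M).2.1^T (g M).2.1 (g M).2.2 = M.
    by rewrite -{1}[M]submxK zpat_block => /andP[_ /eqP->]; rewrite submxK.
  apply: (card_pred_bij (g := g)) => [M N|M|[A [u d]]].
  - rewrite !inE => /andP[zM _] /andP[zN _] gMN.
    by rewrite -(gK M zM) gMN gK.
  - rewrite !inE => /andP[zM rM]; rewrite gK // rM andbT.
    by move: zM; rewrite -{1}[M]submxK zpat_block => /andP[].
  - rewrite !inE /= => /andP[zA rA]; exists (block_mx A u^T u d).
      by rewrite !inE zpat_block zA eqxx.
    by rewrite /g block_mxKul block_mxKdl block_mxKdr.
rewrite card_pair_sum (bigID (@zpat n e _)) /= [X in (_ + X)%N]big1 ?addn0;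
  last first.
  by move=> A /negPf zA; apply: eq_card0 => ud; rewrite !inE zA.
transitivity (\sum_(A : 'M[Fq q]_n | zpat e A)
    ((\rank A == r.+2) * val q ^ r.+2
     + (\rank A == r.+1) * (val q ^ r.+1 * (val q - 1))
     + (\rank A == r) * ((val q ^ n - val q ^ r) * val q)))%N.
  apply: eq_bigr => A zA; rewrite -card_Fq -card_bordered_rank;
    last by case/zpatP: zA.
  by apply: eq_card => ud; rewrite !inE zA.
have sumE s c : (\sum_(A : 'M[Fq q]_n | zpat e A) (\rank A == s) * c = c * nrk e s
    q)%N.
  rewrite -big_distrl /= mulnC /nrk -sum1_card; congr (_ * _)%N.
  rewrite [RHS]big_mkcondr /=; apply: eq_bigr => A _; by case: eqP.
by rewrite !big_split /= !sumE.
Qed.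

Definition rkcount n (e : rel 'I_n) (s : nat) : fct := fun q => (nrk e s q)%:R.

Lemma rkcount_large n (e : rel 'I_n) s : (n < s)%N -> rkcount e s = fun=> 0.
Proof.
move=> ns; apply: funext => q; rewrite /rkcount /nrk eq_card0 // => M; rewrite !inE.
by have := rank_leq_row M; case: eqP => [->|]; rewrite ?andbF // leqNgt ns.
Qed.

Lemma card_ZG (G : simple_graph) q :
  ([set: ZG G (Fq q)]%classic #= `I_(nrk (@edge G) (nverts G) q))%card.
Proof.
apply: (card_eq_encoding (g := fun M : ZG G (Fq q) => sval M)).
- by move=> [M zM] [N zN] /= MN; apply: eq_exist.
- case=> M [symM [N [MN NM]] zM] /=; rewrite !inE; apply/andP; split;
  first exact/zpatP.
  by rewrite -[_ == _]/(row_free M); apply/row_freeP; exists N.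
- move=> M; rewrite inE => /andP[/zpatP[symM zM] rM].
  have uM : M \in unitmx by rewrite -row_free_unit.
  suff ZM : ZG_matrix M by exists (exist _ M ZM).
  by split=> //; exists (invmx M); rewrite mulmxV ?mulVmx.
Qed.

Lemma rkcount_ZG (G : simple_graph) :
  is_point_count (ZG G) (rkcount (@edge G) (nverts G)).
Proof. exact/is_point_count_Fq/card_ZG. Qed.

(* Corank c is reached from coranks c - 1, c and c + 1 of the graph with an extra
   isolated vertex, since the smallest of the three ranks has an invertible coefficient. *)
Lemma rkcount_Graphs_star n (e : rel 'I_n) s :
  symmetric e -> irreflexive e -> Graphs_star (rkcount e s).
Proof.
have [/rkcount_large-> _ _|] := ltnP n s; first by case: Graphs_star_submodule.
move/subnK; move: (n - s)%N => c; elim/ltn_ind: c n s e => -[|c] IH n s e Dn se ie.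
  (* In corank 0 the matrices are invertible, so this is a generator [Z_G]. *)
  apply: sub_gen_smallest; exists (SimpleGraph se ie).
  have -> : s = n by rewrite -Dn.
  exact: (rkcount_ZG (SimpleGraph se ie)).
have VG := Graphs_star_submodule.
(* The coefficient of rank s in [nrk_isolate]; q^n - q^s = q^s (q^(n-s) - 1) lies in [SS] because
   the corank n - s is positive. *)
pose s1 : {poly int} := ('X^n - 'X^s) * 'X.
have SSs1 : SS s1.
  rewrite /s1 -Dn exprD -{2}['X^s]mul1r -mulrBl.
  by apply: SSM SSX; apply: SSM (SSXn _); apply: SSXn1.
apply: (submodule_cancel VG SSs1).
have -> : (fun q => evalq s1 q * rkcount e s q) = (fun q =>
    rkcount (isolate e) s.+2 q - (evalq ('X^(s.+2)) q * rkcount e s.+2 q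
      + evalq ('X^(s.+1) * ('X - 1)) q * rkcount e s.+1 q)).
  apply: funext => q; rewrite /rkcount nrk_isolate !natrD !natrM !natrB.
  - by rewrite /s1 !evalqE !natrX [_ ^+ s.+2]exprS; ring.
  - by rewrite leq_pexp2l // ?(ltnW (primepower_gt1 q)) // -Dn leq_addl.
  - exact: ltnW (primepower_gt1 q).
apply: (submodule_additive VG).2.
  apply: (IH c) => //; first by lia.
    exact: isolate_sym.
  exact: isolate_irr.
apply: (submoduleD VG); apply: (submoduleZ VG); last by apply: (IH c) => //; lia.
(* In corank 1 the rank s + 2 exceeds n and contributes zero. *)
case: c IH Dn {s1 SSs1} => [|c] IH Dn; last by apply: (IH c) => //; lia.
by rewrite rkcount_large; [case: VG|lia].
Qed.

(** * Von Staudt constructions *)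

Definition vec (R : Type) : Type := (R * R * R)%type.

Definition vco (R : Type) (k : nat) (v : vec R) : R :=
  match k with 0 => v.1.1 | 1 => v.1.2 | _ => v.2 end.

Definition dot (R : comPzRingType) (v w : vec R) : R :=
  v.1.1 * w.1.1 + v.1.2 * w.1.2 + v.2 * w.2.

Definition vscale (R : comPzRingType) (c : R) (v : vec R) : vec R :=
  (c * v.1.1, c * v.1.2, c * v.2).

Definition vev I (R : comPzRingType) (y : I -> R) (w : vec (expr I)) : vec R :=
  (ev y w.1.1, ev y w.1.2, ev y w.2).

Definition unit_vec I (k : nat) : vec (expr I) :=
  (if k == 0 then One else Zero, if k == 1 then One else Zero,
   if k == 2 then One else Zero).

(* Over every ring, x |-> x_k w is the projection onto the common orthogonal of a
   and b; al and be are the coefficients witnessing x - x_k w in (x.a, x.b). *)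
Definition cross_cert I (k : nat) (w a b al be : vec (expr I)) : Prop :=
  forall (R : comPzRingType) (y : I -> R),
  [/\ vco k (vev y w) = 1, dot (vev y w) (vev y a) = 0,
      dot (vev y w) (vev y b) = 0
    & forall (x : vec R) i, (i < 3)%N ->
      vco i x - vco k x * vco i (vev y w) =
        vco i (vev y al) * dot x (vev y a) + vco i (vev y be) * dot x (vev y b)].

(* Homogeneous coordinates of points ([false]) and lines ([true]) of the plane
   obtained from the frame and the points (1 : y_i : 0) by joining and
   intersecting; every step stays nondegenerate for all values of the y_i. *)
Inductive constructible I : bool -> vec (expr I) -> Prop :=
  | constr_unit p k : (k < 3)%N -> constructible p (unit_vec I k)
  | constr_one : constructible false (One, One, One)
  | constr_var i : constructible false (One, Var i, Zero)
  | constr_cross p k w a b al be :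
      (k < 3)%N -> cross_cert k w a b al be ->
      constructible (~~ p) a -> constructible (~~ p) b -> constructible p w.

Declare Scope expr_scope.

Section Gadgets.
Variable I : Type.
Local Notation E k := (unit_vec I k%N).
Local Notation "0" := (@Zero I) : expr_scope.
Local Notation "1" := (@One I) : expr_scope.
Local Notation "- t" := (Opp t) : expr_scope.
Local Notation "t + u" := (Add t u) : expr_scope.
Local Notation "t * u" := (Mul t u) : expr_scope.
Local Notation C := (@constructible I).

Ltac cert :=
  move=> R y; rewrite /vev /dot /vco /unit_vec /=;
  split; [ring | ring | ring | move=> [[x0 x1] x2] [|[|[|//]]] _ /=; ring].

(** Obtains the goal as join or meet of a and b; k is a coordinate where it equals 1, and al and be
    are the coefficients for [cross_cert]. *)
Ltac cross k al be a b :=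
  apply: (@constr_cross I _ k _ a b al be); [by [] | cert | | ].

Local Open Scope expr_scope.

(** Auxiliary elements: the [D] are the lines x_i = x_j through the unit point, the [S] their meets
    with the sides of the frame triangle, the [Z] lines joining two of the [S]; [N12] is the centre
    used to move a scale from one side to another. *)
Lemma constr_D01 : C true (1, Opp 1, 0).
Proof.
by cross 0%N (0, Opp 1, 1) (0, 1, 0) (E 2) (1, 1, 1);
  [apply: constr_unit|apply: constr_one].
Qed.

Lemma constr_D02 : C true (1, 0, Opp 1).
Proof.
by cross 0%N (0, 1, Opp 1) (0, 0, 1) (E 1) (1, 1, 1);
  [apply: constr_unit|apply: constr_one].
Qed.

Lemma constr_D12 : C true (0, 1, Opp 1).
Proof.
by cross 1%N (1, 0, Opp 1) (0, 0, 1) (E 0) (1, 1, 1);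
  [apply: constr_unit|apply: constr_one].
Qed.

Lemma constr_S01 : C false (1, 1, 0).
Proof.
by cross 0%N (0, 0, 1) (0, Opp 1, 0) (E 2) (1, Opp 1, 0);
  [apply: constr_unit|apply: constr_D01].
Qed.

Lemma constr_S02 : C false (1, 0, 1).
Proof.
by cross 0%N (0, 1, 0) (0, 0, Opp 1) (E 1) (1, 0, Opp 1);
  [apply: constr_unit|apply: constr_D02].
Qed.

Lemma constr_S12 : C false (0, 1, 1).
Proof.
by cross 1%N (1, 0, 0) (0, 0, Opp 1) (E 0) (0, 1, Opp 1);
  [apply: constr_unit|apply: constr_D12].
Qed.

Lemma constr_Z0 : C true (Opp 1, 1, 1).
Proof.
by cross 1%N (1, 0, Opp 1) (0, 0, 1) (1, 1, 0) (1, 0, 1);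
  [apply: constr_S01|apply: constr_S02].
Qed.

Lemma constr_Z2 : C true (1, 1, Opp 1).
Proof.
by cross 0%N (0, Opp 1, 1) (0, 1, 0) (1, 0, 1) (0, 1, 1);
  [apply: constr_S02|apply: constr_S12].
Qed.

Lemma constr_N12 : C false (0, 1, Opp 1).
Proof.
by cross 1%N (1, 0, 1) (0, 0, 1) (E 0) (Opp 1, 1, 1);
  [apply: constr_unit|apply: constr_Z0].
Qed.

Lemma constr_Mone : C false (1, Mone, 0).
Proof.
by cross 0%N (0, 1, 1) (0, 1, 0) (E 2) (1, 1, Opp 1);
  [apply: constr_unit|apply: constr_Z2].
Qed.

(** Perspectivity with centre (0 : 1 : -1) from the line x_2 = 0 to the line x_1 = 0;
    [constr_unswap] is its inverse. *)
Lemma constr_swap t : C false (1, t, 0) -> C false (1, 0, t).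
Proof.
move=> Ct; cross 0%N (0, 1, Opp 1) (0, 0, 1) (E 1) (- t, 1, 1);
  first exact: constr_unit.
by cross 1%N (1, 0, 0) (0, 0, Opp 1) (1, t, 0) (0, 1, Opp 1);
  last apply: constr_N12.
Qed.

Lemma constr_unswap t : C false (1, 0, t) -> C false (1, t, 0).
Proof.
move=> Ct; cross 0%N (0, Opp 1, 1) (0, 1, 0) (E 2) (- t, 1, 1);
  first exact: constr_unit.
by cross 1%N (1, 0, 0) (t, 0, Opp 1) (1, 0, t) (0, 1, Opp 1);
  last apply: constr_N12.
Qed.

(** With x_0 = 0 at infinity this is the intercept theorem: the parallel through (t, 0) to the line
    from (1, 0) to (0, u) meets the second axis in (0, tu). *)
Lemma constr_mul t u :
  C false (1, t, 0) -> C false (1, u, 0) -> C false (1, t * u, 0).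
Proof.
move=> Ct /constr_swap Cu; apply: constr_unswap.
cross 0%N (0, 1, - u) (0, 0, 1) (E 1) (- (t * u), u, 1); first exact: constr_unit.
cross 2%N (1, 0, 0) (- t, 1, 0) (1, t, 0) (0, 1, - u) => //.
cross 1%N (1, 0, u) (0, 0, 1) (E 0) (- u, u, 1); first exact: constr_unit.
by cross 2%N (1, Opp 1, 0) (0, 1, 0) (1, 0, u) (1, 1, 0); last apply: constr_S01.
Qed.

(** In the affine plane x_0 = 1 the parallels to the axes give the point (t, u), and the line of
    slope -1 through it meets the first axis in (t + u, 0). *)
Lemma constr_add t u :
  C false (1, t, 0) -> C false (1, u, 0) -> C false (1, t + u, 0).
Proof.
move=> Ct /constr_swap Cu.
cross 0%N (0, Opp 1, 1) (0, 1, 0) (E 2) (- (t + u), 1, 1); first exact: constr_unit.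
cross 1%N (1, 0, 0) (u, 0, Opp 1) (1, t, u) (0, 1, Opp 1); last exact: constr_N12.
cross 0%N (0, 1, 0) (0, 0, 1) (- t, 1, 0) (- u, 0, 1).
  by cross 1%N (0, 0, 1) (1, 0, 0) (E 2) (1, t, 0); first apply: constr_unit.
by cross 2%N (0, 1, 0) (1, 0, 0) (E 1) (1, 0, u); first apply: constr_unit.
Qed.

Lemma constr_expr t : C false (1, t, 0).
Proof.
elim: t => [i||t IHt u IHu|t IHt u IHu].
- exact: constr_var.
- exact: constr_Mone.
- exact: constr_add.
- exact: constr_mul.
Qed.

End Gadgets.

(** * Configurations *)

(* Vertex k of a configuration carries its position and its incidences with
   earlier vertices: (j, true) demands a zero entry in place (k, j) of the matrix,
   (j, false) a nonzero one. *)
Record vertex (I : Type) := Vertex {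
  pole : bool;
  pos : vec (expr I);
  inc : seq (nat * bool) }.

Definition vertex0 I := Vertex false (unit_vec I 0) [::].

(* The three lines at the end have a nondegenerate pairing with the first three
   points, which forces the matrix to have rank at least 3. *)
Definition frame_head I : seq (vertex I) := [::
  Vertex false (unit_vec I 0) [::];
  Vertex false (unit_vec I 1) [:: (0, true)];
  Vertex false (unit_vec I 2) [:: (0, true); (1, true)];
  Vertex false (One, One, One) [:: (0, false); (1, false); (2, false)];
  Vertex true (unit_vec I 0) [:: (1, true); (2, true); (0, false)];
  Vertex true (unit_vec I 1) [:: (0, true); (2, true); (1, false)];
  Vertex true (unit_vec I 2) [:: (0, true); (1, true); (2, false)]]%N.

Definition frame (I : finType) : seq (vertex I) :=
  frame_head I ++
  [seq Vertex false (One, Var i, Zero) [:: (0, false); (2, true)]%N | i <- enum I].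

Definition vnth I (cfg : seq (vertex I)) k := nth (vertex0 I) cfg k.

(** The first three vertices form a self-polar triangle for a diagonal form, so each of them serves
    both as a point and as a line. *)
Definition partner I (cfg : seq (vertex I)) (p : bool) (a : vec (expr I)) (i :
    nat) :=
  [/\ (i < size cfg)%N, pos (vnth cfg i) = a & (i < 3)%N \/ pole (vnth cfg i) = ~~
    p].

(** Each further vertex is a join or meet of earlier ones. Its entry (k, false) makes coordinate k
    nonzero and so excludes the zero vector. *)
Inductive valid (I : finType) : seq (vertex I) -> Prop :=
  | valid_frame : valid (frame I)
  | valid_cross cfg p k w a b al be i j :
      valid cfg -> (k < 3)%N -> cross_cert k w a b al be ->
      partner cfg p a i -> partner cfg p b j ->
      valid (rcons cfg (Vertex p w [:: (i, true); (j, true); (k, false)])).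

Section Geometry.
Variables (F : fieldType) (d : vec F).
Hypothesis d_neq0 : [/\ d.1.1 != 0, d.1.2 != 0 & d.2 != 0].

Definition form (v w : vec F) : F :=
  d.1.1 * v.1.1 * w.1.1 + d.1.2 * v.1.2 * w.1.2 + d.2 * v.2 * w.2.

(** The polarity of the diagonal form: for p true, these are the coordinates of the polar line of
    v. *)
Definition dual (p : bool) (v : vec F) : vec F :=
  if p then (d.1.1 * v.1.1, d.1.2 * v.1.2, d.2 * v.2) else v.

Definition undual (p : bool) (v : vec F) : vec F :=
  if p then (v.1.1 / d.1.1, v.1.2 / d.1.2, v.2 / d.2) else v.

Lemma undualK p : cancel (undual p) (dual p).
Proof.
case: d_neq0 => d0 d1 d2; case: p => -[[v0 v1] v2] //=.
by rewrite /dual /undual /= mulrC divfK // mulrC divfK // mulrC divfK.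
Qed.

Lemma dualK p : cancel (dual p) (undual p).
Proof.
case: d_neq0 => d0 d1 d2; case: p => -[[v0 v1] v2] //=.
by rewrite /dual /undual /= mulrAC divff // mul1r mulrAC divff // mul1r mulrAC
  divff // mul1r.
Qed.

Lemma formC v w : form v w = form w v.
Proof. by rewrite /form; ring. Qed.

(** Orthogonality of a point and a pole becomes incidence of a point and a line, from which d has
    disappeared. *)
Lemma form_dual p p' v w : p = ~~ p' -> form v w = dot (dual p v) (dual p' w).
Proof. by case: p' => ->; rewrite /form /dot /dual /=; ring. Qed.

Lemma vev_unit I (y : I -> F) k :
  vev y (unit_vec I k) = ((k == 0%N)%:R, (k == 1%N)%:R, (k == 2)%:R).
Proof.
by rewrite /vev /unit_vec /=; do 3 case: eqP => _; rewrite ?ev_One ?ev_Zero.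
Qed.

Lemma form_unit (I : Type) (y : I -> F) p c v k : c != 0 -> (k < 3)%N ->
  (form v (vscale c (vev y (unit_vec I k))) == 0) =
  (dot (dual p v) (vscale c (vev y (unit_vec I k))) == 0).
Proof.
case: d_neq0 => d0 d1 d2 c0; rewrite vev_unit.
move: k => [|[|[|//]]] _; rewrite /form /dot /dual /vscale /=;
  rewrite !(mulr0, mulr1, addr0, add0r); case: p => //=;
  by rewrite !mulf_eq0 (negPf c0) (negPf d0, negPf d1, negPf d2).
Qed.

Lemma dot_unit (I : Type) (y : I -> F) c v k : c != 0 -> (k < 3)%N ->
  (dot v (vscale c (vev y (unit_vec I k))) == 0) = (vco k v == 0).
Proof.
move=> c0; rewrite vev_unit.
move: k => [|[|[|//]]] _; rewrite /dot /vscale /=;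
  by rewrite !(mulr0, mulr1, addr0, add0r) mulf_eq0 (negPf c0) orbF.
Qed.

Lemma dotC (v w : vec F) : dot v w = dot w v.
Proof. by rewrite /dot; ring. Qed.

Lemma dot_scaler c' (v w : vec F) : dot v (vscale c' w) = c' * dot v w.
Proof. by rewrite /dot /vscale /=; ring. Qed.

Lemma cross_unique I (y : I -> F) k w a b al be x :
  cross_cert k w a b al be -> dot x (vev y a) = 0 -> dot x (vev y b) = 0 ->
  x = vscale (vco k x) (vev y w).
Proof.
case/(_ F y) => _ _ _ H xa xb.
have H' i : (i < 3)%N -> vco i x = vco k x * vco i (vev y w).
  by move/(H x i); rewrite xa xb !mulr0 addr0 => /eqP; rewrite subr_eq0 => /eqP.
move: (H' 0%N isT) (H' 1%N isT) (H' 2%N isT); case: x {xa xb H'} => [[x0 x1] x2] /=.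
by rewrite /vscale /= => <- <- <-.
Qed.

End Geometry.

Section Placement.
Variables (I : finType) (F : fieldType) (d : vec F).
Hypothesis d_neq0 : [/\ d.1.1 != 0, d.1.2 != 0 & d.2 != 0].
Implicit Types (cfg : seq (vertex I)) (V : nat -> vec F) (y : I -> F).

Definition respects cfg V := forall k, (k < size cfg)%N ->
  forall c, c \in inc (vnth cfg k) -> (form d (V k) (V c.1) == 0) = c.2.

(** While [respects] is what the zero pattern of the matrix shows, [placed] says that the vectors
    realize the configuration at y up to scalars. For normalized vectors the first amounts to the
    second for some y. *)
Definition placed cfg V y := forall k, (k < size cfg)%N ->
  exists c, c != 0 /\ dual d (pole (vnth cfg k)) (V k) = vscale c (vev y (pos
    (vnth cfg k))).

Definition normalized V :=
  (forall k, (k < 3)%N -> exists2 c, c != 0 &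
     V k = vscale c ((k == 0%N)%:R, (k == 1%N)%:R, (k == 2)%:R)) /\ V 3 = (1, 1, 1).

Lemma valid_prefix cfg : valid cfg -> exists s, cfg = frame I ++ s.
Proof.
elim=> [|cfg' p k w a b al be i j _ [s ->] _ _ _ _]; first by exists [::];
  rewrite cats0.
by exists (rcons s (Vertex p w [:: (i, true); (j, true); (k, false)]));
  rewrite -rcons_cat.
Qed.

Lemma vnth_head cfg k : valid cfg -> (k < 7)%N -> vnth cfg k = vnth (frame_head I)
    k.
Proof.
by case/valid_prefix=> s -> k7; rewrite /vnth /frame -catA nth_cat k7.
Qed.

Lemma size_frame : size (frame I) = (7 + #|I|)%N.
Proof. by rewrite size_cat size_map -cardE. Qed.

Lemma size_valid cfg : valid cfg -> (7 + #|I| <= size cfg)%N.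
Proof. by case/valid_prefix=> s ->; rewrite size_cat size_frame leq_addr. Qed.

Lemma vnth_var cfg i : valid cfg ->
  vnth cfg (7 + enum_rank i) =
    Vertex false (One, Var i, Zero) [:: (0, false); (2, true)]%N.
Proof.
case/valid_prefix=> s ->; rewrite /vnth nth_cat size_frame ltn_add2l ltn_ord.
rewrite /frame nth_cat ltnNge leq_addr.
rewrite [size _]/= addKn.
by rewrite (nth_map i) -?cardE ?ltn_ord // nth_enum_rank.
Qed.

Lemma frame_index k : (k < 7 + #|I|)%N -> (k < 7)%N \/ exists i : I, k = (7 +
    enum_rank i)%N.
Proof.
have [k7|k7] := ltnP k 7; [by left|right].
have lt : (k - 7 < #|I|)%N by lia.
by exists (enum_val (Ordinal lt)); rewrite enum_valK /=; lia.
Qed.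

Lemma placed_unit cfg V y p v k : valid cfg -> placed cfg V y -> (k < 3)%N ->
  (form d v (V k) == 0) = (vco k (dual d p v) == 0).
Proof.
move=> val pl k3; have k7 : (k < 7)%N by lia.
have [|c [c0]] := pl k; first by have := size_valid val; lia.
rewrite vnth_head // => Vk.
have {}Vk : V k = vscale c (vev y (unit_vec I k)).
  by move: k k3 Vk {k7} => [|[|[|]]].
by rewrite Vk (form_unit d_neq0 y p) // dot_unit.
Qed.

Lemma placed_partner cfg V y p a i v : valid cfg -> placed cfg V y -> partner cfg
    p a i ->
  (form d v (V i) == 0) = (dot (dual d p v) (vev y a) == 0).
Proof.
move=> val pl [i_lt <- partner_i]; have [c [c0 Vi]] := pl i i_lt.
have scE w : (dot w (vscale c (vev y (pos (vnth cfg i)))) == 0)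
           = (dot w (vev y (pos (vnth cfg i))) == 0).
  by rewrite dot_scaler mulf_eq0 (negPf c0).
rewrite -scE; case: partner_i => [i3|pole_i]; last first.
  by rewrite -Vi -form_dual // pole_i negbK.
rewrite (placed_unit p v val pl i3) vnth_head //; last by lia.
have -> : pos (vnth (frame_head I) i) = unit_vec I i.
  by move: i i3 {i_lt Vi scE} => [|[|[|]]].
by rewrite dot_unit.
Qed.

Lemma vnth_rcons cfg v k : (k < size cfg)%N -> vnth (rcons cfg v) k = vnth cfg k.
Proof. by move=> k_lt; rewrite /vnth nth_rcons k_lt. Qed.

Lemma vnth_last cfg v : vnth (rcons cfg v) (size cfg) = v.
Proof. by rewrite /vnth nth_rcons ltnn eqxx. Qed.

Lemma placed_rcons cfg v V y : placed (rcons cfg v) V y -> placed cfg V y.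
Proof.
move=> pl k k_lt; have := pl k; rewrite vnth_rcons //; apply.
by rewrite size_rcons ltnS ltnW.
Qed.

Lemma vco_scale c (v : vec F) k : vco k (vscale c v) = c * vco k v.
Proof. by move: k => [|[|k]]. Qed.

Lemma frame_inc y k c : (k < 7 + #|I|)%N -> c \in inc (vnth (frame I) k) ->
  (c.1 < 3)%N /\ (vco c.1 (vev y (pos (vnth (frame I) k))) == 0) = c.2.
Proof.
have val := valid_frame I.
case/frame_index=> [k7|[i ->]]; last first.
  rewrite (vnth_var i val) !inE => /orP[] /eqP-> /=; split=> //=.
    by rewrite mulrNN mulr1 oner_eq0.
  by rewrite mulrNN mulr1 subrr eqxx.
rewrite vnth_head //; case: k k7 => [|[|[|[|[|[|[|//]]]]]]] _ /=;
  rewrite ?inE //; do ?[case/orP]; move/eqP-> => /=;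
  by rewrite ?mulrNN ?mulr1 ?subrr ?oner_eq0 ?eqxx.
Qed.

Lemma placed_respects cfg V y : valid cfg -> placed cfg V y -> respects cfg V.
Proof.
move=> val; elim: val V => [|{}cfg p k w a b al be i j val IH k3 cert pa pb] V pl.
  move=> k; rewrite size_frame => k_lt c inc_c.
  have [|c' [c'0 Vk]] := pl k; first by rewrite size_frame.
  have [c3 <-] := frame_inc y k_lt inc_c.
  rewrite (placed_unit (pole (vnth (frame I) k)) _ (valid_frame I) pl c3) Vk.
  by rewrite vco_scale mulf_eq0 (negPf c'0).
have pl' := placed_rcons pl.
move=> m; rewrite size_rcons ltnS leq_eqVlt => /orP[/eqP->|m_lt]; last first.
  by move=> c; rewrite vnth_rcons //; apply: IH.
have [|c' [c'0]] := pl (size cfg); first by rewrite size_rcons.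
have [w1 wa wb _] := cert F y.
rewrite vnth_last /= => VN c; rewrite !inE => /or3P[]/eqP-> /=.
- by rewrite (placed_partner _ val pl' pa) VN dotC dot_scaler dotC wa mulr0 eqxx.
- by rewrite (placed_partner _ val pl' pb) VN dotC dot_scaler dotC wb mulr0 eqxx.
- by rewrite (placed_unit p _ val pl' k3) VN vco_scale w1 mulr1 (negPf c'0).
Qed.

(** The parameters y are read off the vertices of the variables in the frame; every later vertex is
    then determined up to a scalar by [cross_unique]. *)
Lemma respects_placed cfg V : valid cfg -> normalized V -> respects cfg V ->
  exists y, placed cfg V y.
Proof.
move=> val [V012 V3]; elim: val => [|{}cfg p k w a b al be i j val IH k3 cert pa
  pb] resp.
  have val := valid_frame I.
  pose y (i : I) := vco 1 (V (7 + enum_rank i)%N) / vco 0 (V (7 + enum_rank i)%N).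
  exists y => k; rewrite size_frame => k_lt.
  have unitE p v m : (m < 3)%N -> (form d v (V m) == 0) = (vco m (dual d p v) == 0).
    move=> m3; have [c c0 ->] := V012 m m3.
    by rewrite -(vev_unit y) (form_unit d_neq0 y p) // dot_unit.
  have respE c : c \in inc (vnth (frame I) k) ->
      (vco c.1 (dual d (pole (vnth (frame I) k)) (V k)) == 0) = c.2.
    move=> inc_c; rewrite -unitE; first by apply: resp; rewrite ?size_frame.
    by have [] := frame_inc y k_lt inc_c.
  case/frame_index: k_lt respE => [k7|[i ->]]; last first.
    rewrite (vnth_var i val) /=; set v := V _ => respE.
    have v0 : v.1.1 != 0 by rewrite [_ == 0](respE (0%N, false)) ?inE ?eqxx.
    have v2 : v.2 = 0 by apply/eqP; rewrite [_ == 0](respE (2%N, true)) ?inE ?eqxx.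
    exists v.1.1; split=> //; rewrite /vev /vscale /= mulrNN mulr1 subrr mulr1
      mulr0.
    rewrite /y -/v /= mulrC divfK // -v2.
    by case: (v) => [[]].
  rewrite (vnth_head val k7).
  have cross3 (x : vec F) m : (m < 3)%N -> vco m x != 0 ->
      (forall l, (l < 3)%N -> l != m -> vco l x = 0) ->
      exists c, c != 0 /\ x = vscale c (vev y (unit_vec I m)).
    move=> m3 xm xl; exists (vco m x); split=> //; rewrite vev_unit.
    case: x xm xl => [[x0 x1] x2].
    case: m m3 => [|[|[|//]]] _ _ xl; rewrite /vscale /= !(mulr0, mulr1).
    - by have /= -> := xl 1%N isT isT; have /= -> := xl 2%N isT isT.
    - by have /= -> := xl 0%N isT isT; have /= -> := xl 2%N isT isT.
    - by have /= -> := xl 0%N isT isT; have /= -> := xl 1%N isT isT.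
  have frame3 m : (m < 3)%N ->
      exists c, c != 0 /\ V m = vscale c (vev y (unit_vec I m)).
    by move=> m3; have [c c0 Vm] := V012 m m3; exists c; rewrite vev_unit.
  case: k k7 => [|[|[|[|[|[|[|//]]]]]]] _ respE; try exact: frame3.
  - exists 1; rewrite oner_neq0; split=> //=.
    by rewrite V3 /vev /vscale /= mulrNN !mulr1.
  - apply: cross3 => //; first by rewrite [_ == 0](respE (0%N, false)) ?inE ?eqxx
    ?orbT.
    case=> [|[|[|//]]] // _ _; apply/eqP.
      by rewrite [_ == 0](respE (1%N, true)) ?inE ?eqxx ?orbT.
    by rewrite [_ == 0](respE (2%N, true)) ?inE ?eqxx ?orbT.
  - apply: cross3 => //; first by rewrite [_ == 0](respE (1%N, false)) ?inE ?eqxx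
    ?orbT.
    case=> [|[|[|//]]] // _ _; apply/eqP.
      by rewrite [_ == 0](respE (0%N, true)) ?inE ?eqxx ?orbT.
    by rewrite [_ == 0](respE (2%N, true)) ?inE ?eqxx ?orbT.
  - apply: cross3 => //; first by rewrite [_ == 0](respE (2%N, false)) ?inE ?eqxx
    ?orbT.
    case=> [|[|[|//]]] // _ _; apply/eqP.
      by rewrite [_ == 0](respE (0%N, true)) ?inE ?eqxx ?orbT.
    by rewrite [_ == 0](respE (1%N, true)) ?inE ?eqxx ?orbT.
have [|y pl] := IH.
  move=> m m_lt c inc_c; apply: resp; rewrite ?vnth_rcons //.
  by rewrite size_rcons ltnS ltnW.
exists y => m; rewrite size_rcons ltnS leq_eqVlt => /orP[/eqP->|m_lt]; last first.
  by rewrite vnth_rcons //; apply: pl.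
rewrite vnth_last /=; have := resp (size cfg);
  rewrite size_rcons leqnn vnth_last /=.
move=> /(_ isT) inc_w; set x := dual d p (V (size cfg)).
have xa : dot x (vev y a) = 0.
  by apply/eqP; rewrite -(placed_partner _ val pl pa) (inc_w (i, true)) ?inE ?eqxx.
have xb : dot x (vev y b) = 0.
  by apply/eqP; rewrite -(placed_partner _ val pl pb) (inc_w (j, true)) ?inE ?eqxx
    ?orbT.
exists (vco k x); split; last exact: cross_unique cert xa xb.
by rewrite -(placed_unit p _ val pl k3) (inc_w (k, false)) ?inE ?eqxx ?orbT.
Qed.
End Placement.

(** * Gram matrices of rank 3 *)

Section Realization.
Variable I : finType.
Implicit Type cfg : seq (vertex I).

Lemma partner_cat cfg s p a i : partner cfg p a i -> partner (cfg ++ s) p a i.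
Proof.
case=> i_lt pos_i pole_i; split; first by rewrite size_cat ltn_addr.
  by rewrite /vnth nth_cat i_lt.
by rewrite /vnth nth_cat i_lt.
Qed.

(** Any valid [cfg] may be extended, so that the two operands of a construction can be appended one
    after the other. A partner is indexed by the type of the vertices incident with it, hence
    [~~ p]. *)
Lemma constructible_realized p w : @constructible I p w ->
  forall cfg, valid cfg ->
  exists s i, valid (cfg ++ s) /\ partner (cfg ++ s) (~~ p) w i.
Proof.
elim=> {p w} [p k k3||v|p k w a b al be k3 cert _ IHa _ IHb] cfg val.
- exists [::], k; rewrite cats0; split=> //; split; last by left.
    by have := size_valid val; lia.
  by rewrite (vnth_head val) //; [move: k k3 => [|[|[|]]]|lia].
- exists [::], 3; rewrite cats0; split=> //; split.
  + by have := size_valid val; lia.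
  + by rewrite (vnth_head val).
  + by right; rewrite (vnth_head val).
- exists [::], (7 + enum_rank v)%N; rewrite cats0; split=> //; split.
  + by apply: leq_trans (size_valid val); rewrite ltn_add2l ltn_ord.
  + by rewrite (vnth_var v val).
  + by right; rewrite (vnth_var v val).
have [s1 [i [val1 pa]]] := IHa cfg val; have [s2 [j [val2 pb]]] := IHb _ val1.
rewrite -catA negbK in val2 pb; rewrite negbK in pa.
have {}pa := partner_cat s2 pa; rewrite -catA in pa.
pose v := Vertex p w [:: (i, true); (j, true); (k, false)].
exists (rcons (s1 ++ s2) v), (size (cfg ++ s1 ++ s2)); rewrite -rcons_cat.
split; first exact: valid_cross val2 k3 cert pa pb.
by split; rewrite ?size_rcons // vnth_last //= negbK; right.
Qed.

Lemma constr_expr_realized (T : seq (expr I)) :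
  exists cfg, valid cfg /\
    forall t, t \in T -> exists i, partner cfg true (One, t, Zero) i.
Proof.
elim: T => [|t T [cfg [val IH]]]; first by exists (frame I); split;
  first exact: valid_frame.
have [s [i [val' pi]]] := constructible_realized (constr_expr t) val.
exists (cfg ++ s); split=> // u; rewrite inE => /orP[/eqP->|/IH[j pj]].
  by exists i.
by exists j; apply: partner_cat.
Qed.

End Realization.

Section GramRank3.
Variables (F : fieldType) (n : nat) (M : 'M[F]_n) (e f : 'I_3 -> 'I_n).
Hypothesis Mfe : forall i j, (M (e j) (f i) == 0) = (i != j).

(** On the columns [f] the three rows form an invertible diagonal matrix. *)
Lemma rowsub_free : row_free (rowsub e M).
Proof.
apply/row_freeP; exists (\matrix_(i, l) ((i == f l)%:R / M (e l) (f l))).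
apply/matrixP=> k l; rewrite !mxE (bigD1 (f l)) //= big1 => [|i /negPf ne].
  rewrite !mxE eqxx addr0 mul1r; have [->|ne] := eqVneq k l.
    by rewrite divff // Mfe eqxx.
  have /eqP -> : M (e k) (f l) == 0 by rewrite Mfe eq_sym.
  by rewrite mul0r.
by rewrite !mxE ne mul0r mulr0.
Qed.

Lemma rowsub_submx : (rowsub e M <= M)%MS.
Proof. by apply/row_subP=> i; rewrite row_rowsub row_sub. Qed.

Lemma mxrank_gram3 (Y : 'M_(n, 3)) (de : 'rV_3) :
  M = Y *m diag_mx de *m Y^T -> \rank M = 3.
Proof.
move=> DM; apply/anti_leq/andP; split.
  by rewrite DM -mulmxA (leq_trans (mxrankM_maxl _ _)) ?rank_leq_col.
by have := mxrankS rowsub_submx; rewrite (eqP rowsub_free).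
Qed.

Hypothesis symM : M^T = M.
Hypothesis Mee : forall i j, i != j -> M (e i) (e j) = 0.
Hypothesis rkM : \rank M = 3.

(** In rank 3 the independent rows [e] span all rows. Their block on the columns [e] is diagonal, so
    the coefficients are read off there. *)
Lemma gram3_coeff :
  exists D : 'M_(n, 3), M = D *m rowsub e M /\ forall i k, M i (e k) = D i k * M
    (e k) (e k).
Proof.
have /submxP[D DM] : (M <= rowsub e M)%MS.
  have [_ <-] := mxrank_leqif_sup rowsub_submx.
  by rewrite rkM (eqP rowsub_free).
exists D; split=> // i k; rewrite {1}DM !mxE (bigD1 k) //= big1 ?addr0 ?mxE //.
by move=> l ne; rewrite !mxE Mee // mulr0.
Qed.

(** Otherwise the whole column e k would vanish, against its entry in row f k. *)
Lemma gram3_diag_neq0 k : M (e k) (e k) != 0.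
Proof.
have [D [_ DE]] := gram3_coeff.
have : M (f k) (e k) != 0 by rewrite -symM mxE Mfe eqxx.
by rewrite DE mulf_eq0 negb_or => /andP[].
Qed.

(** Expansion in the orthogonal basis indexed by [e]. *)
Lemma gram3_entry i j : M i j = \sum_k M i (e k) * M j (e k) / M (e k) (e k).
Proof.
have [D [DM DE]] := gram3_coeff.
rewrite {1}DM mxE; apply: eq_bigr => k _; rewrite mxE -{1}symM mxE [M i _]DE.
by rewrite (mulrAC (D i k)) mulfK ?gram3_diag_neq0.
Qed.

End GramRank3.

(** Constraints carry natural numbers as indices; out of range the entry reads 0, so that a zero
    condition there holds trivially. *)
Definition ent (F : fieldType) n (M : 'M[F]_n) (i j : nat) : F :=
  if insub i is Some i' then if insub j is Some j' then M i' j' else 0 else 0.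

Lemma ent_ord (F : fieldType) n (M : 'M[F]_n) (i j : 'I_n) : ent M i j = M i j.
Proof. by rewrite /ent !valK. Qed.

Definition meets (F : fieldType) n (M : 'M[F]_n) (c : nat * nat * bool) :=
  (ent M c.1.1 c.1.2 == 0) == c.2.

Definition ncs n (cs : seq (nat * nat * bool)) (q : primepower) : nat :=
  #|[pred M : 'M[Fq q]_n | [&& M^T == M, \rank M == 3 & all (meets M) cs]]|.

Definition cscount n cs : fct := fun q => (ncs n cs q)%:R.

Lemma cscount_Graphs_star n cs :
  (forall c, c \in cs -> c.1.1 != c.1.2) -> Graphs_star (cscount n cs).
Proof.
have VG := Graphs_star_submodule.
(* The accumulator collects the zero conditions already treated; once no condition is left, they are
   the edges of a graph. *)
rewrite -[cs]cat0s; have : all (fun c : nat * nat * bool => c.2) [::] by [].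
elim: cs [::] => [|[[i j] [|]] cs IH] zs zsT irr.
- have e_sym : symmetric (fun i j : 'I_n =>
    ((val i, val j, true) \in zs) || ((val j, val i, true) \in zs)).
    by move=> i j /=; rewrite orbC.
  have e_irr : irreflexive (fun i j : 'I_n =>
    ((val i, val j, true) \in zs) || ((val j, val i, true) \in zs)).
    move=> i /=; rewrite orbb; apply/negP=> i_zs.
    by have := irr (val i, val i, true); rewrite mem_cat i_zs eqxx => /(_ isT).
  have := rkcount_Graphs_star 3 e_sym e_irr; congr (Graphs_star _).
  apply: funext => q; congr _%:R; apply: eq_card => M; rewrite !inE cats0.
  rewrite andbA andbAC; congr (_ && _).
  apply/zpatP/andP => [[symM zM]|[/eqP symM /allP zM]].
    split; first exact/eqP.
    apply/allP=> -[[i j] b] c_zs; have /= := allP zsT _ c_zs.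
    case: b c_zs => // c_zs _; rewrite /meets /= eqb_id /ent.
    case: insubP => // i' _ Di; case: insubP => // j' _ Dj.
    by rewrite zM // Di Dj c_zs.
  split=> // i j /orP[]/zM; rewrite /meets /= ent_ord eqb_id => /eqP //.
  by move=> Mji; rewrite -symM mxE.
- rewrite -cat_rcons in irr *; apply: IH => //; first by rewrite all_rcons.
have -> : cscount n (zs ++ (i, j, false) :: cs) = (fun q =>
    cscount n (zs ++ cs) q - cscount n (rcons zs (i, j, true) ++ cs) q).
  apply: funext => q; rewrite /cscount; apply/eqP; rewrite eq_sym subr_eq;
    apply/eqP.
  rewrite -natrD; congr _%:R.
  rewrite /ncs -[LHS](cardID [pred M : 'M[Fq q]_n | ent M i j == 0]) addnC.
  congr (_ + _)%N; apply: eq_card => M; rewrite !inE ?cat_rcons !all_cat /= /meets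
    /=.
    by case: (ent M i j == 0); rewrite ?andbF ?andbT.
  by case: (ent M i j == 0); rewrite ?andbF ?andbT.
apply: (submodule_additive VG).2.
  by apply: IH => // c c_in; apply: irr; move: c_in;
    rewrite !mem_cat inE => /orP[->|->]; rewrite ?orbT.
apply: IH; first by rewrite all_rcons.
move=> c; rewrite cat_rcons mem_cat inE => /or3P[c_in|/eqP->|c_in].
- by apply: irr; rewrite mem_cat c_in.
- by have := irr (i, j, false); rewrite mem_cat inE eqxx orbT => /(_ isT).
- by apply: irr; rewrite mem_cat inE c_in !orbT.
Qed.

(** * Counting the matrices of a configuration *)

Definition incidences I (cfg : seq (vertex I)) : seq (nat * nat * bool) :=
  [seq (k, c.1, c.2) | k <- iota 0 (size cfg), c <- inc (vnth cfg k)].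

Lemma mem_incidences I (cfg : seq (vertex I)) k j b :
  (k, j, b) \in incidences cfg <-> (k < size cfg)%N /\ (j, b) \in inc (vnth cfg k).
Proof.
split=> [/allpairsPdep[k' [[j' b'] [+ + [-> -> ->]]]]|[k_lt inc_jb]].
  by rewrite mem_iota.
by apply/allpairsPdep; exists k, (j, b); rewrite mem_iota.
Qed.

Lemma inc_lt (I : finType) (cfg : seq (vertex I)) k c :
  valid cfg -> (k < size cfg)%N -> c \in inc (vnth cfg k) -> (c.1 < k)%N.
Proof.
move=> val; elim: val k c => [|{}cfg p k w a b al be i j val IH k3 _ pa pb] m c.
  rewrite size_frame => /frame_index[m7|[i ->]]; last first.
    by rewrite (vnth_var i (valid_frame I)) !inE => /orP[]/eqP->.
  rewrite (vnth_head (valid_frame I) m7).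
  by case: m m7 => [|[|[|[|[|[|[|//]]]]]]] _ /=; rewrite ?inE //; do ?[case/orP];
    move/eqP->.
rewrite size_rcons ltnS leq_eqVlt => /orP[/eqP->|m_lt]; last first.
  by rewrite vnth_rcons //; apply: IH.
have := size_valid val; case: pa pb => [i_lt _ _] [j_lt _ _] sz.
by rewrite vnth_last !inE => /or3P[]/eqP-> //=; lia.
Qed.

Lemma vev_neq0 (I : finType) (R : comNzRingType) (y : I -> R) (cfg : seq (vertex
    I)) k :
  valid cfg -> (k < size cfg)%N ->
  exists2 m, (m < 3)%N & vco m (vev y (pos (vnth cfg k))) = 1.
Proof.
move=> val; elim: val k => [|{}cfg p k w a b al be i j val IH k3 cert pa pb] m.
  rewrite size_frame => /frame_index[m7|[i ->]]; last first.
    by exists 0%N; rewrite // (vnth_var i (valid_frame I)) /= mulrNN mulr1.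
  rewrite (vnth_head (valid_frame I) m7).
  by case: m m7 => [|[|[|[|[|[|[|//]]]]]]] _ /=;
    [exists 0%N|exists 1%N|exists 2%N|exists 0%N|exists 0%N|exists 1%N|exists 2%N];
    rewrite //= mulrNN mulr1.
rewrite size_rcons ltnS leq_eqVlt => /orP[/eqP->|m_lt]; last first.
  by rewrite vnth_rcons //; apply: IH.
by exists k => //; rewrite vnth_last; case: (cert R y).
Qed.

Lemma card_ffun_forall (J : finType) (F : finType) (P : J -> pred F) :
  #|[pred f : {ffun J -> F} | [forall k, P k (f k)]]| = (\prod_k #|P k|)%N.
Proof.
transitivity #|family P|; first by apply: eq_card => f; rewrite !inE.
by rewrite card_family foldrE big_map big_enum.
Qed.

Lemma card_neq0 (F : finFieldType) : #|[pred x : F | x != 0]| = (#|F| - 1)%N.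
Proof.
by rewrite subn1 -(cardC1 (0 : F)); apply: eq_card => x; rewrite !inE.
Qed.

Section Encoding.
Variables (I : finType) (T : seq (expr I)) (cfg : seq (vertex I)) (reg : expr I ->
  nat).
Hypotheses (vld : valid cfg)
  (regP : forall t, t \in T -> partner cfg true (One, t, Zero) (reg t)).

Local Notation N := (size cfg).
(** Vertex [reg t] is the point (1 : t : 0), and its orthogonality to vertex 1, a multiple of the
    second unit vector, says t = 0. *)
Definition constraints := incidences cfg ++ [seq (reg t, 1%N, true) | t <- T].

Lemma constraints_irr c : c \in constraints -> c.1.1 != c.1.2.
Proof.
case: c => [[k j] b]; rewrite mem_cat => /orP[/mem_incidences[k_lt inc_k]|/mapP[t
  tT [-> -> _]]].
  by rewrite gtn_eqF // (inc_lt vld k_lt inc_k).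
apply/eqP => /= reg1; have [_ + _] := regP tT.
by rewrite reg1 (vnth_head vld).
Qed.

Lemma size_cfg : (7 <= N)%N.
Proof. exact: leq_trans (leq_addr _ _) (size_valid vld). Qed.

Lemma head_lt k : (k < 7)%N -> (k < N)%N.
Proof. by move=> k7; apply: leq_trans k7 size_cfg. Qed.

Definition head_ord k (k7 : (k < 7)%N) : 'I_N := Ordinal (head_lt k7).

Fact e_subproof (k : 'I_3) : (k < 7)%N. Proof. by apply: leq_trans (ltn_ord k) _.
  Qed.
Fact f_subproof (k : 'I_3) : (4 + k < 7)%N. Proof. by rewrite (ltn_add2l 4 k 3).
  Qed.

(** Places 0 to 2 hold the basis points ([eo]), place 3 the unit point ([uo]), and places 4 to 6 the
    lines paired with the basis points ([fo]). *)
Definition eo (k : 'I_3) : 'I_N := head_ord (e_subproof k).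
Definition fo (k : 'I_3) : 'I_N := head_ord (f_subproof k).
Definition uo : 'I_N := head_ord (isT : 3 < 7)%N.

Section Field.
Variable F : finFieldType.

Lemma meets_head (M : 'M[F]_N) (i j : 'I_N) b : all (meets M) constraints ->
  (i < 7)%N -> (val j, b) \in inc (vnth (frame_head I) i) -> (M i j == 0) = b.
Proof.
move=> /allP H i7 inc_ij; suff /H : (val i, val j, b) \in constraints.
  by rewrite /meets /= ent_ord => /eqP.
rewrite mem_cat; apply/orP; left; apply/mem_incidences.
by rewrite ltn_ord (vnth_head vld).
Qed.

Section HeadEntries.
Variable M : 'M[F]_N.
Hypotheses (symM : M^T = M) (Mcs : all (meets M) constraints).

Lemma head_fe i j : (M (eo j) (fo i) == 0) = (i != j).
Proof.
rewrite -symM mxE; apply: meets_head => //; first exact: f_subproof.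
by move: i j => [[|[|[|//]]] ?] [[|[|[|//]]] ?]; rewrite !inE.
Qed.

Lemma head_ee i j : i != j -> M (eo i) (eo j) = 0.
Proof.
wlog lt_ji : i j / (j < i)%N => [H|] ne.
  have [lt_ij|lt_ji|eq_ij] := ltngtP i j;
      last by rewrite (val_inj eq_ij) eqxx in ne.
    by rewrite -symM mxE H // eq_sym.
  exact: H.
apply/eqP; rewrite (meets_head (b := true)) //; first exact: e_subproof.
by move: i j lt_ji {ne} => [[|[|[|//]]] ?] [[|[|[|//]]] ?]; rewrite !inE.
Qed.

Lemma head_ue i : M uo (eo i) != 0.
Proof.
rewrite (meets_head (b := false)) //.
by move: i => [[|[|[|//]]] ?]; rewrite !inE.
Qed.
End HeadEntries.

Definition ovec (d : 'I_3 -> F) : vec F :=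
  (d (@Ordinal 3 0 isT), d (@Ordinal 3 1 isT), d (@Ordinal 3 2 isT)).

Lemma vco_ovec d (k : 'I_3) : vco k (ovec d) = d k.
Proof. by case: k => [[|[|[|//]]] ?] /=; congr (d _); apply: val_inj. Qed.

Lemma form_sum d v w : form (ovec d) v w = \sum_k d k * vco k v * vco k w.
Proof.
rewrite /form !big_ord_recl big_ord0 /= addr0 addrA.
by congr (_ + _ + _); congr (d _ * _ * _); apply: val_inj.
Qed.

Definition cnat (c : 'I_N -> F) (k : nat) : F := if insub k is Some i then c i
    else 1.

Lemma cnat_ord c (i : 'I_N) : cnat c i = c i.
Proof. by rewrite /cnat valK. Qed.

(** The weights of a diagonal form, a scalar for each vertex, and the values of the variables. *)
Definition params : finType :=
  ({ffun 'I_3 -> F} * {ffun 'I_N -> F} * {ffun I -> F})%type.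

Definition paramV (p : params) (k : nat) : vec F :=
  undual (ovec p.1.1) (pole (vnth cfg k)) (vscale (cnat p.1.2 k) (vev p.2 (pos
    (vnth cfg k)))).

Definition paramM (p : params) : 'M[F]_N :=
  \matrix_(i, j) form (ovec p.1.1) (paramV p i) (paramV p j).

Definition dom_d : pred {ffun 'I_3 -> F} := [pred d : {ffun 'I_3 -> F} | [forall
    k, d k != 0]].
(** Scaling all vectors by l and the weights by l^-2 preserves the Gram matrix; the scalar 1 at the
    unit point removes this freedom. *)
Definition dom_c : pred {ffun 'I_N -> F} :=
  [pred c : {ffun 'I_N -> F} | [forall k : 'I_N, if k == uo then c k == 1 else c k
    != 0]].
Definition dom_y : pred {ffun I -> F} := [pred y : {ffun I -> F} | vanish T y].
Definition dom : pred params := [pred p : params | [&& dom_d p.1.1, dom_c p.1.2 &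
    dom_y p.2]].

Section DomFacts.
Variable p : params.
Hypothesis dom_p : dom p.

Lemma dom_d_neq0 : [/\ (ovec p.1.1).1.1 != 0, (ovec p.1.1).1.2 != 0 & (ovec
    p.1.1).2 != 0].
Proof. by have /and3P[/forallP d0 _ _] := dom_p; split; apply: d0. Qed.

Lemma dom_c_neq0 (i : 'I_N) : p.1.2 i != 0.
Proof.
have /and3P[_ /forallP/(_ i) + _] := dom_p.
by case: eqP => // _ /eqP->; rewrite oner_eq0.
Qed.

Lemma dom_c_unit : p.1.2 uo = 1.
Proof.
by have /and3P[_ /forallP/(_ uo) + _] := dom_p; rewrite eqxx => /eqP.
Qed.

Lemma dual_paramV k : dual (ovec p.1.1) (pole (vnth cfg k)) (paramV p k) =
  vscale (cnat p.1.2 k) (vev p.2 (pos (vnth cfg k))).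
Proof. by rewrite undualK //; apply: dom_d_neq0. Qed.

Lemma param_placed : placed (ovec p.1.1) cfg (paramV p) p.2.
Proof.
move=> k k_lt; exists (cnat p.1.2 k); split; last exact: dual_paramV.
by rewrite -[k]/(val (Ordinal k_lt)) cnat_ord dom_c_neq0.
Qed.

Lemma ent_paramM i j : (i < N)%N -> (j < N)%N ->
  ent (paramM p) i j = form (ovec p.1.1) (paramV p i) (paramV p j).
Proof.
move=> i_lt j_lt.
by rewrite -[i]/(val (Ordinal i_lt)) -[j]/(val (Ordinal j_lt)) ent_ord mxE.
Qed.

Lemma paramM_sym : (paramM p)^T = paramM p.
Proof. by apply/matrixP=> i j; rewrite !mxE formC. Qed.

Lemma paramM_meets : all (meets (paramM p)) constraints.
Proof.
have resp := placed_respects dom_d_neq0 vld param_placed.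
apply/allP=> -[[k j] b]; rewrite mem_cat => /orP[/mem_incidences[k_lt inc_k]|].
  have j_lt := ltn_trans (inc_lt vld k_lt inc_k) k_lt.
  by rewrite /meets /= ent_paramM // (resp k k_lt _ inc_k) eqxx.
case/mapP=> t tT [-> -> ->]; have [r_lt pos_r _] := regP tT.
rewrite /meets /= (ent_paramM r_lt (head_lt (isT : 1 < 7)%N)) eqb_id.
rewrite (placed_unit dom_d_neq0 (pole (vnth cfg (reg t))) _ vld param_placed) //.
rewrite dual_paramV pos_r /=.
have /and3P[_ _ /vanishP yT] := dom_p.
by rewrite yT ?mulr0.
Qed.

Lemma paramM_rank : \rank (paramM p) = 3.
Proof.
apply: (mxrank_gram3 (e := eo) (f := fo) (head_fe paramM_sym paramM_meets)
  (Y := \matrix_(i, k) vco k (paramV p i)) (de := \row_k p.1.1 k)).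
apply/matrixP=> i j; rewrite !mxE form_sum; apply: eq_bigr => k _.
by rewrite mul_mx_diag !mxE [_ * p.1.1 k]mulrC.
Qed.

Lemma paramV_unit (k : 'I_3) :
  paramV p k = vscale (p.1.2 (eo k)) ((k == 0%N :> nat)%:R, (k == 1%N :> nat)%:R,
    (k == 2 :> nat)%:R).
Proof.
rewrite -(vev_unit p.2) -(cnat_ord _ (eo k)) /paramV (vnth_head vld) ?e_subproof //.
by case: k => [[|[|[|//]]] ?].
Qed.

Lemma paramV_one : paramV p 3 = (1, 1, 1).
Proof.
have c3 : cnat p.1.2 3 = 1 by rewrite (cnat_ord _ uo) dom_c_unit.
rewrite /paramV (vnth_head vld) // c3.
by rewrite /vscale /= mulrNN !mulr1.
Qed.

Lemma paramM_eo (i : 'I_N) (k : 'I_3) :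
  paramM p i (eo k) = p.1.1 k * p.1.2 (eo k) * vco k (paramV p i).
Proof.
rewrite mxE form_sum (bigD1 k) //= big1 => [|l ne].
  by rewrite addr0 paramV_unit vco_scale; case: k => [[|[|[|//]]] ?] /=; ring.
rewrite paramV_unit vco_scale.
by move: k l ne => [[|[|[|//]]] ?] [[|[|[|//]]] ?] //= _; rewrite !mulr0.
Qed.

End DomFacts.

(** The entries with the unit vertex are d_k c_k and the diagonal ones d_k c_k^2, which gives d and
    the basis scalars, then all vectors. The vertices of the variables give y, and a coordinate of
    the position equal to 1 gives each remaining scalar. *)
Lemma paramM_inj : {in dom &, injective paramM}.
Proof.
move=> p p' dom_p dom_p' eqM.
have dcE q : dom q -> forall k : 'I_3, q.1.1 k * q.1.2 (eo k) = paramM q uo (eo k).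
  move=> dom_q k; rewrite paramM_eo // paramV_one // [vco _ _](_ : _ = 1) ?mulr1 //.
  by case: k => [[|[|[|//]]] ?].
have cE q : dom q -> forall k : 'I_3,
    q.1.2 (eo k) = paramM q (eo k) (eo k) / paramM q uo (eo k).
  move=> dom_q k; rewrite -dcE // paramM_eo // paramV_unit // vco_scale.
  have [dom_d0 dom_c0 _] := and3P dom_q.
  have dc0 : q.1.1 k * q.1.2 (eo k) != 0.
    by rewrite mulf_neq0 ?dom_c_neq0 //; apply: (forallP dom_d0).
  rewrite mulrAC divff // mul1r.
  by case: (k) => [[|[|[|//]]] ?] /=; rewrite mulr1.
have c_eq (k : 'I_3) : p.1.2 (eo k) = p'.1.2 (eo k) by rewrite !cE // eqM.
have d_eq : p.1.1 = p'.1.1.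
  apply/ffunP=> k; apply: (mulIf (dom_c_neq0 dom_p' (eo k))).
  by rewrite -[in LHS]c_eq !dcE // eqM.
have V_eq (i : 'I_N) : paramV p i = paramV p' i.
  have H k : vco k (paramV p i) = vco k (paramV p' i) \/ (3 <= k)%N.
    have [k3|k3] := ltnP k 3; [left|by right].
    have [dom_d0 dom_c0 _] := and3P dom_p.
    apply: (@mulfI _ (p.1.1 (Ordinal k3) * p.1.2 (eo (Ordinal k3)))).
      by rewrite mulf_neq0 ?dom_c_neq0 //; apply: (forallP dom_d0).
    by rewrite -(paramM_eo p i (Ordinal k3)) eqM paramM_eo d_eq c_eq.
  case: (H 0%N) (H 1%N) (H 2%N) => // + [] // + [] //.
  by case: (paramV p i) (paramV p' i) => [[? ?] ?] [[? ?] ?] /= -> -> ->.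
have x_eq (i : 'I_N) : vscale (p.1.2 i) (vev p.2 (pos (vnth cfg i))) =
    vscale (p'.1.2 i) (vev p'.2 (pos (vnth cfg i))).
  by rewrite -!cnat_ord -!dual_paramV // d_eq V_eq.
have y_eq : p.2 = p'.2.
  apply/ffunP=> v; have v_lt : (7 + enum_rank v < N)%N.
    by apply: leq_trans (size_valid vld); rewrite ltn_add2l ltn_ord.
  have := x_eq (Ordinal v_lt); rewrite (vnth_var v vld : vnth cfg (Ordinal v_lt) =
      _) => -[] /=.
  rewrite mulrNN !mulr1 => -> /mulfI-> //.
  exact: dom_c_neq0.
suff c_all : p.1.2 = p'.1.2.
  by move: d_eq y_eq c_all; case: (p) (p') => [[? ?] ?] [[? ?] ?] /= -> -> ->.
apply/ffunP=> i; have [m m3 w1] := vev_neq0 p'.2 vld (ltn_ord i).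
have := congr1 (vco m) (x_eq i); rewrite y_eq !vco_scale.
by rewrite w1 !mulr1.
Qed.

Lemma paramM_surj (M : 'M[F]_N) :
  M^T = M -> \rank M = 3 -> all (meets M) constraints ->
  exists2 p, p \in dom & paramM p = M.
Proof.
move=> symM rkM Mcs.
have fe := head_fe symM Mcs; have ee := head_ee symM Mcs; have ue := head_ue Mcs.
have de0 k : M (eo k) (eo k) != 0 := gram3_diag_neq0 fe symM ee rkM k.
(* The expansion of [gram3_entry], rescaled so that the unit vertex gets the vector (1, 1, 1). *)
pose d := [ffun k => M uo (eo k) ^+ 2 / M (eo k) (eo k)].
pose V k := ovec (fun l => ent M k (eo l) / M uo (eo l)).
have formV (i j : 'I_N) : form (ovec d) (V i) (V j) = M i j.
  rewrite form_sum (gram3_entry fe symM ee rkM i j); apply: eq_bigr => k _.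
  rewrite !vco_ovec !ent_ord ffunE.
  by field; rewrite de0 ue.
have d_neq0 : [/\ (ovec d).1.1 != 0, (ovec d).1.2 != 0 & (ovec d).2 != 0].
  by split; rewrite /= ffunE mulf_neq0 ?expf_neq0 ?invr_eq0.
have resp : respects (ovec d) cfg V.
  move=> k k_lt [j b] inc_jb; have j_lt := ltn_trans (inc_lt vld k_lt inc_jb) k_lt.
  rewrite (formV (Ordinal k_lt) (Ordinal j_lt)).
  have /(allP Mcs) : (k, j, b) \in constraints.
    by rewrite mem_cat; apply/orP; left; apply/mem_incidences.
  rewrite /meets /= -[k]/(\val (Ordinal k_lt)) -[j]/(\val (Ordinal j_lt)) ent_ord.
  by move/eqP.
have normV : normalized V.
  split=> [k k3|]; last first.
    by rewrite /V /ovec !(ent_ord M uo) !divff.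
  exists (M (eo (Ordinal k3)) (eo (Ordinal k3)) / M uo (eo (Ordinal k3))).
    by rewrite mulf_neq0 ?invr_eq0.
  rewrite /V /ovec !(ent_ord M (eo (Ordinal k3))) /vscale /=.
  case: k k3 => [|[|[|//]]] k3; rewrite /= !(mulr0, mulr1).
  - by rewrite (ee (Ordinal k3) (@Ordinal 3 1 isT)) // (ee (Ordinal k3) (@Ordinal
    3 2 isT)) // !mul0r; congr (M _ _ / M _ _, _, _); apply: val_inj.
  - by rewrite (ee (Ordinal k3) (@Ordinal 3 0 isT)) // (ee (Ordinal k3) (@Ordinal
    3 2 isT)) // !mul0r; congr (_, M _ _ / M _ _, _); apply: val_inj.
  - by rewrite (ee (Ordinal k3) (@Ordinal 3 0 isT)) // (ee (Ordinal k3) (@Ordinal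
    3 1 isT)) // !mul0r; congr (_, _, M _ _ / M _ _); apply: val_inj.
have [y0 pl] := respects_placed d_neq0 vld normV resp.
have /choice[c0 c0P] (i : 'I_N) : exists c, c != 0 /\
    dual (ovec d) (pole (vnth cfg i)) (V i) = vscale c (vev y0 (pos (vnth cfg i))).
  exact: pl.
pose p : params := (d, finfun c0, finfun y0).
have evy t : ev p.2 t = ev y0 t by apply: eq_ev => i; rewrite ffunE.
exists p; last first.
  apply/matrixP=> i j; rewrite mxE -formV.
  have VE (k : 'I_N) : paramV p k = V k.
    rewrite /paramV cnat_ord ffunE -[RHS](dualK d_neq0 (pole (vnth cfg k))).
    by case: (c0P k) => _ ->; rewrite /vev !evy.
  by rewrite !VE.
apply/and3P; split.
- by apply/forallP=> k; rewrite ffunE mulf_neq0 ?expf_neq0 ?invr_eq0.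
- apply/forallP=> k; rewrite ffunE; case: eqP => [->|_]; last by case: (c0P k).
  have [_] := c0P uo; rewrite (vnth_head vld) //= normV.2 => -[].
  by rewrite mulrNN !mulr1 => <-.
apply/vanishP=> t tT; rewrite evy.
have [r_lt pos_r _] := regP tT; have [c [c_neq0 xr]] := pl _ r_lt.
have /(allP Mcs) : (reg t, 1%N, true) \in constraints.
  by rewrite mem_cat; apply/orP; right; apply/mapP; exists t.
have oneE : 1%N = \val (eo (@Ordinal 3 1 isT)) by [].
rewrite /meets /= -[reg t]/(\val (Ordinal r_lt)) oneE ent_ord -formV eqb_id /=.
rewrite (placed_unit d_neq0 (pole (vnth cfg (reg t))) _ vld pl) // xr pos_r /=.
by rewrite mulf_eq0 (negPf c_neq0) => /eqP.
Qed.

Lemma card_dom : #|dom| = (#|dom_d| * #|dom_c| * #|dom_y|)%N.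
Proof.
by rewrite -!cardX; apply: eq_card => -[[d c] y]; rewrite !inE /= andbA.
Qed.

Lemma card_dom_d : #|dom_d| = ((#|F| - 1) ^ 3)%N.
Proof.
rewrite (card_ffun_forall (fun=> [pred x : F | x != 0])) prod_nat_const card_ord.
by rewrite card_neq0.
Qed.

Lemma card_dom_c : #|dom_c| = (\prod_(k < N) if k == uo then 1 else #|F| - 1)%N.
Proof.
rewrite (card_ffun_forall (fun k : 'I_N =>
  [pred x : F | if k == uo then x == 1 else x != 0])).
apply: eq_bigr => k _; case: ifP => _; last exact: card_neq0.
by rewrite -(card1 (1 : F)); apply: eq_card => x; rewrite !inE.
Qed.
End Field.

(** Counts the weights and scalars in [dom], with no choice of scalar at the unit vertex. *)
Definition scaling : {poly int} :=
  ('X - 1) ^+ 3 * \prod_(k < N) if k == uo then 1 else 'X - 1.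

Lemma SS_scaling : SS scaling.
Proof.
apply: SSM; last by apply: SS_prod => k; case: ifP => _; [apply: SS1|apply: SSX1].
by rewrite -(card_ord 3) -prodr_const; apply: SS_prod => _; apply: SSX1.
Qed.

(** [paramM] is a bijection from [dom] onto the matrices counted. *)
Lemma cscount_constraints : cscount N constraints = fun q => evalq scaling q * aff
    T q.
Proof.
apply: funext => q.
have -> : evalq scaling q = (#|@dom_d (Fq q)| * #|@dom_c (Fq q)|)%:R.
  rewrite card_dom_d card_dom_c evalqM natrM natrX natr_prod; congr (_ * _).
    rewrite !exprS expr0 !evalqE natrB ?(ltnW (finNzRing_gt1 _)) // card_Fq; ring.
  rewrite (big_morph (evalq^~ q) (fun a b => evalqM a b q) (evalq1 q)).
  apply: eq_bigr => k _; case: ifP => _; rewrite !evalqE // natrB ?card_Fq //.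
  by rewrite ltnW // primepower_gt1.
rewrite /aff -natrM -[naff T q]/#|@dom_y (Fq q)| -card_dom; congr _%:R.
apply/esym/(card_pred_bij (g := @paramM (Fq q))) => [|p dom_p|M].
- exact: paramM_inj.
- by rewrite !inE paramM_sym eqxx paramM_rank //= paramM_meets.
- by rewrite !inE => /and3P[/eqP symM /eqP rkM Mcs]; apply: paramM_surj.
Qed.

End Encoding.

Lemma aff_Graphs_star (I : finType) (T : seq (expr I)) : Graphs_star (aff T).
Proof.
have [cfg [vld regs]] := constr_expr_realized T.
have /choice[reg regP] (t : expr I) :
    exists i, t \in T -> partner cfg true (One, t, Zero) i.
  have [/regs[i pi]|ntT] := boolP (t \in T); first by exists i.
  by exists 0%N.
apply: (submodule_cancel Graphs_star_submodule (SS_scaling vld)).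
rewrite -(cscount_constraints vld regP); apply: cscount_Graphs_star.
exact: constraints_irr vld regP.
Qed.

(** * The two modules coincide *)

Lemma Mot_plus_aff_span : Mot_plus = aff_span.
Proof.
apply/seteqP; split=> f; apply; split; try exact: smallest_additive_subgroup.
  by move=> g [X]; apply: scheme_aff_span.
by move=> g [I [T ->]]; apply: Mot_plus_aff.
Qed.

Lemma subgroup_mulz V (c : int) f :
  additive_subgroup V -> V f -> V (fun q => c%:~R * f q).
Proof.
move=> VG Vf.
have nat_mul n : V (fun q => n%:R * f q).
  elim: n => [|n IHn].
    by have -> : (fun q => 0%:R * f q) = fun=> 0; [apply: funext => q;
      rewrite mul0r|case: VG].
  have -> : (fun q => n.+1%:R * f q) = (fun q => f q + n%:R * f q).
    by apply: funext => q; rewrite -natr1 mulrDl mul1r addrC.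
  exact: subgroupD.
case: c => n; first exact: nat_mul.
have -> : (fun q => (Negz n)%:~R * f q) = (fun q => - (n.+1%:R * f q)).
  by apply: funext => q; rewrite NegzE mulrNz mulNr.
exact: subgroupN.
Qed.

Lemma Mot_plus_mulX f : Mot_plus f -> Mot_plus (fun q => evalq 'X q * f q).
Proof.
have [M0 MB] : additive_subgroup Mot_plus := smallest_additive_subgroup _.
rewrite {1}Mot_plus_aff_span.
(* The functions whose product with q lies in [Mot_plus] form a subgroup, so only the generators of
   [aff_span] need checking. *)
move=> /(_ (fun f => Mot_plus (fun q => evalq 'X q * f q))); apply.
split=> [|_ [I [T ->]]]; first split=> [|g h Mg Mh].
- by have -> : (fun q => evalq 'X q * 0) = fun=> 0; first by apply: funext => q;
  rewrite mulr0.
- have -> : (fun q => evalq 'X q * (g q - h q)) =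
      (fun q => evalq 'X q * g q - evalq 'X q * h q).
    by apply: funext => q; rewrite mulrBr.
  exact: MB.
have -> : (fun q => evalq 'X q * aff T q) = aff (map (rename Some) T).
  by apply: funext => q; rewrite /aff naff_mulq natrM evalqX.
exact: Mot_plus_aff.
Qed.

Lemma Mot_plus_mulp p f : Mot_plus f -> Mot_plus (fun q => evalq p q * f q).
Proof.
have MG : additive_subgroup Mot_plus := smallest_additive_subgroup _.
move=> Mf; elim/poly_ind: p => [|p c IHp].
  by rewrite evalq0; have := MG.1; congr Mot_plus; apply: funext => q;
    rewrite mul0r.
have -> : (fun q => evalq (p * 'X + c%:P) q * f q) =
    (fun q => evalq 'X q * (evalq p q * f q) + c%:~R * f q).
  by apply: funext => q; rewrite evalqD evalqM [evalq c%:P q]/evalq hornerC; ring.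
exact: (subgroupD MG (Mot_plus_mulX IHp) (subgroup_mulz c MG Mf)).
Qed.

Lemma Mot_submodule : R_submodule Mot.
Proof.
have MG : additive_subgroup Mot_plus := smallest_additive_subgroup _.
split.
- exists (fun=> 0), 1; split; [exact: MG.1|exact: SS1|].
  by apply: funext => q; rewrite mul0r.
- move=> _ _ [g [s [Mg Ss ->]]] [h [t [Mh St ->]]].
  exists (fun q => evalq t q * g q + evalq s q * h q), (s * t); split.
  + exact: (subgroupD MG (Mot_plus_mulp t Mg) (Mot_plus_mulp s Mh)).
  + exact: SSM.
  + apply: funext => q; rewrite evalqM.
    by field; rewrite !SS_evalq_neq0.
- move=> _ _ [p [s [Ss ->]]] [g [t [Mg St ->]]].
  exists (fun q => evalq p q * g q), (s * t); split.
  + exact: Mot_plus_mulp.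
  + exact: SSM.
  + apply: funext => q; rewrite evalqM.
    by field; rewrite !SS_evalq_neq0.
Qed.

(** * The functor Z_G as the zero set of integral equations *)

Section InvertibleMatrixEquations.
Variable G : simple_graph.
Local Notation n := (nverts G).
(** The flag [true] marks the entries of the matrix, [false] those of its inverse. *)
Local Notation var := (bool * ('I_n * 'I_n))%type.

Definition esum I (s : seq (expr I)) : expr I := foldr (@Add I) Zero s.

Lemma ev_esum I (R : comPzRingType) (y : I -> R) s :
  ev y (esum s) = \sum_(t <- s) ev y t.
Proof.
by elim: s => [|t s /= ->]; rewrite ?big_nil ?ev_Zero // big_cons.
Qed.

Lemma vanish_enum (I J : finType) (R : comPzRingType) (y : I -> R) (t : J -> expr
    I) :
  reflect (forall j, ev y (t j) = 0) (vanish [seq t j | j <- enum J] y).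
Proof.
apply: (iffP (vanishP _ _)) => [H j|H _ /mapP[j _ ->] //].
by apply/H/map_f; rewrite mem_enum.
Qed.

Definition eq_sym_at (ij : 'I_n * 'I_n) : expr var :=
  Add (Var (true, ij)) (Opp (Var (true, (ij.2, ij.1)))).
Definition eq_inv_at (ij : 'I_n * 'I_n) : expr var :=
  Add (esum [seq Mul (Var (true, (ij.1, k))) (Var (false, (k, ij.2))) | k <- enum
    'I_n])
    (Opp (if ij.1 == ij.2 then One else Zero)).
Definition eq_edge_at (ij : 'I_n * 'I_n) : expr var :=
  if edge ij.1 ij.2 then Var (true, ij) else Zero.

Definition ZG_equations : seq (expr var) :=
  [seq eq_sym_at ij | ij <- enum {: 'I_n * 'I_n}] ++
  [seq eq_inv_at ij | ij <- enum {: 'I_n * 'I_n}] ++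
  [seq eq_edge_at ij | ij <- enum {: 'I_n * 'I_n}].

Lemma ZG_equationsP (F : finFieldType) (y : var -> F) :
  let M b : 'M[F]_n := \matrix_(i, j) y (b, (i, j)) in
  reflect (zpat (@edge G) (M true) /\ M true *m M false = 1%:M) (vanish
    ZG_equations y).
Proof.
move=> M; rewrite /vanish !all_cat -!/(vanish _ _).
apply: (iffP and3P) => [[/vanish_enum sy /vanish_enum inv /vanish_enum
  ed]|[/zpatP[sy ed] inv]].
  split; first (apply/zpatP; split).
  - apply/matrixP=> i j; rewrite !mxE; apply/esym/eqP.
    by rewrite -subr_eq0 -(sy (i, j)) /= mulN1r.
  - by move=> i j eij; have := ed (i, j); rewrite /eq_edge_at /= eij mxE.
  apply/matrixP=> i j; rewrite !mxE; apply/eqP; rewrite -subr_eq0; apply/eqP.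
  rewrite -[RHS](inv (i, j)) /= ev_esum big_map big_enum /= mulN1r.
  congr (_ - _); first by apply: eq_bigr => k _; rewrite !mxE.
  by case: eqP => _; rewrite ?ev_One ?ev_Zero.
split; apply/vanish_enum => -[i j].
- by rewrite /= mulN1r; have := congr1 (fun A : 'M[F]_n => A j i) sy;
  rewrite !mxE => ->; rewrite subrr.
- rewrite /= ev_esum big_map big_enum /= mulN1r.
  have <- : (M true *m M false) i j = \sum_k y (true, (i, k)) * y (false, (k, j)).
    by rewrite mxE; apply: eq_bigr => k _; rewrite !mxE.
  by rewrite inv mxE; case: eqP => _; rewrite ?ev_One ?ev_Zero subrr.
- rewrite /eq_edge_at /=; case: ifP => [/ed|_]; last exact: ev_Zero.
  by rewrite mxE.
Qed.

(** The inverse is determined by the matrix, so forgetting it is a bijection. *)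
Lemma naff_ZG q : naff ZG_equations q = nrk (@edge G) n q.
Proof.
pose M b (y : {ffun var -> Fq q}) : 'M[Fq q]_n := \matrix_(i, j) y (b, (i, j)).
apply: (card_pred_bij (g := M true)) => [y y'|y|A].
- rewrite !inE => /ZG_equationsP[_ inv] /ZG_equationsP[_ inv'] eqM.
  have eqM' : M false y = M false y'.
    rewrite -[LHS]mul1mx -(mulmx1C inv') -mulmxA.
    by rewrite -[_ *m M false y]/(M true y' *m M false y) -eqM inv mulmx1.
  apply/ffunP=> -[b [i j]].
  have : M b y i j = M b y' i j by case: b; rewrite ?eqM ?eqM'.
  by rewrite !mxE.
- rewrite !inE => /ZG_equationsP[-> inv] /=.
  by rewrite -[_ == _]/(row_free _); apply/row_freeP; exists (M false y).
- rewrite inE => /andP[zA rA]; have uA : A \in unitmx by rewrite -row_free_unit.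
  pose y : {ffun var -> Fq q} :=
    [ffun v => (if v.1 then A else invmx A) v.2.1 v.2.2].
  have yE b : M b y = if b then A else invmx A.
    by apply/matrixP=> i j; rewrite !mxE ffunE.
  exists y; last exact: yE.
  rewrite inE; apply/ZG_equationsP; rewrite -!/(M _ _) !yE; split=> //.
  exact: mulmxV.
Qed.

Lemma Mot_ZG f : is_point_count (ZG G) f -> Mot f.
Proof.
move/(is_point_count_inv (card_ZG G)) => ->.
exists (aff ZG_equations), 1; split; first exact: Mot_plus_aff.
  exact: SS1.
by apply: funext => q; rewrite /aff naff_ZG evalq1 divr1.
Qed.

End InvertibleMatrixEquations.

Theorem theorem1p5 : Graphs_star = Mot.
Proof.
apply/seteqP; split=> f.
  by apply; split=> [|g [G]]; [apply: Mot_submodule|apply: Mot_ZG].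
move=> [g [s [+ Ss ->]]]; rewrite Mot_plus_aff_span => Mg.
have VG := Graphs_star_submodule.
apply: (submodule_div VG Ss); apply: Mg; split; first exact: submodule_additive.
by move=> _ [I [T ->]]; apply: aff_Graphs_star.
Qed.
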